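(* Assume that $Z$ has a finite second moment and that: (i) (linearity condition) $Q_c\,\mathbb{E}[Z|P_cZ]=0$ a.s.; (ii) (diagonal conditional variance) there is a real random variable $\lambda^{\ast}_{\omega}$ such that $\operatorname{var}(Z|P_cZ)=\lambda^{\ast}_{\omega}Q_c$ a.s.; (iii) for every $\eta\in E_c$ with $\|\eta\|=1$, $$\mathbb{P}\left(\mathbb{E}\left[(\eta^TZ)^2|Y\right]=\mathbb{E}\left[\left.\tfrac{\|Q_cZ\|^2}{p-d}\right|Y\right]\right)<1.$$ If $\Psi$ is a total countable family in the space $L_1\big(\mathbb{E}[\|Z\|^2\,|Y=y]\,P_Y(dy)\big)$, then there exists a finite subset $\Psi_H$ of $\Psi$ such that $$\sum_{\psi\in\Psi_H}E_{\psi}=E_c$$ (sum of linear subspaces).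
   Context: $Y$ is a real random variable, $X$ a random vector in $\mathbb{R}^p$ with invertible covariance matrix $\Sigma$, and $Z=\Sigma^{-1/2}(X-\mathbb{E}[X])$, so $\mathbb{E}[Z]=0$ and $\operatorname{var}(Z)=I$. A dimension reduction subspace (DRS) for $Z$ is a linear subspace $E\subset\mathbb{R}^p$ such that $Y$ and $Z$ are conditionally independent given $PZ$, $P$ being the orthogonal projection on $E$. The (standardized) central subspace $E_c$ is the unique DRS of minimal dimension, equal to the intersection of all DRS. Standing assumption: $X$ has a density whose support has a boundary of Lebesgue measure $0$, and $E_c$ exists. $P_c$ is the orthogonal projection on $E_c$, $Q_c=I-P_c$, $d=\dim E_c<p$. $P_Y$ is the law of $Y$. For $\theta:\mathbb{R}\to\mathbb{R}_+$ and a measure $\mu$ on $\mathbb{R}$, $L_1(\theta(y)\mu(dy))$ is the space of functions $u:\mathbb{R}\to\mathbb{R}$ with $\int|u(y)|\theta(y)\mu(dy)<\infty$. A family is total if its linear span is dense. For a measurable $\psi$ with $ZZ^T\psi(Y)$ integrable, $M_\psi=\mathbb{E}[ZZ^T\psi(Y)]$, $\lambda^{\ast}_\psi=\frac{1}{p-d}\mathbb{E}[\|Q_cZ\|^2\psi(Y)]$, and the $\psi$-space is $E_\psi=\operatorname{span}(M_\psi-\lambda_\psi^{\ast}I)$ (the column space), i.e. the orthogonal complement of $\{\eta: M_\psi\eta=\lambda^{\ast}_\psi\eta\}$. *)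

(* Defs.v *)
From HB Require Import structures.
From mathcomp Require Import all_boot all_order all_algebra.
From mathcomp Require Import all_classical all_reals all_analysis measurable_realfun.

Set Implicit Arguments.
Unset Strict Implicit.
Unset Printing Implicit Defensive.

Import Order.TTheory GRing.Theory Num.Theory.
Import numFieldNormedType.Exports.

Local Open Scope classical_set_scope.
Local Open Scope ring_scope.

Definition measure_matrix_display : measure_display -> measure_display.
Proof. exact. Qed.

(* The product sigma-algebra, i.e. the one generated by the entries; for
   matrices over a [realType] it is the Borel sigma-algebra. *)
Definition matrix_measurable (d : measure_display) (T : measurableType d)
    (m n : nat) : set (set 'M[T]_(m, n)) :=
  <<s \bigcup_(ij in [set: 'I_m * 'I_n])
        preimage_set_system setT (fun M : 'M[T]_(m, n) => M ij.1 ij.2)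
          measurable >>.

Section measurable_matrix.
Context (d : measure_display) (T : measurableType d) (m n : nat).

Let mx0 : @matrix_measurable d T m n set0.
Proof. exact: sigma_algebra0. Qed.

Let mxC A : @matrix_measurable d T m n A -> @matrix_measurable d T m n (~` A).
Proof. exact: sigma_algebraC. Qed.

Let mxU (F : (set 'M[T]_(m, n))^nat) :
  (forall i, @matrix_measurable d T m n (F i)) ->
  @matrix_measurable d T m n (\bigcup_i (F i)).
Proof. exact: sigma_algebra_bigcup. Qed.

HB.instance Definition _ := @isMeasurable.Build (measure_matrix_display d)
  'M[T]_(m, n) (@matrix_measurable d T m n) mx0 mxC mxU.

End measurable_matrix.

Lemma measurable_mx_entry (d : measure_display) (T : measurableType d)
    (m n : nat) (i : 'I_m) (j : 'I_n) :
  measurable_fun [set: 'M[T]_(m, n)] (fun M : 'M[T]_(m, n) => M i j).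
Proof.
move=> _ B mB; rewrite setTI; apply: sub_sigma_algebra; exists (i, j) => //=.
by exists B => //; rewrite setTI.
Qed.

Lemma measurable_fun_mxP (d d' : measure_display) (U : measurableType d')
    (T : measurableType d) (m n : nat) (f : U -> 'M[T]_(m, n)) :
  measurable_fun setT f <->
  (forall i j, measurable_fun setT (fun u => f u i j)).
Proof.
split=> [mf i j|mf].
  exact: (measurableT_comp (measurable_mx_entry i j) mf).
have s : @matrix_measurable d T m n `<=` [set A | measurable (f @^-1` A)].
  apply: smallest_sub.
    split=> //=; first by rewrite preimage_set0.
      by move=> A mA; rewrite setTD preimage_setC; exact: measurableC.
    by move=> F mF; rewrite preimage_bigcup; exact: bigcupT_measurable.
  move=> A [[i j] _ [B mB <-]] /=; rewrite setTI.
  by rewrite -[X in measurable X]setTI; exact: (mf i j).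
by move=> _ A mA; rewrite setTI; exact: s.
Qed.

Section lebesgue_cV.
Variable R : realType.

Definition consc (n : nat) (xv : measurableTypeR R * 'cV[R]_n) : 'cV[R]_n.+1 :=
  \col_i (if unlift ord0 i is Some j then xv.2 j 0 else xv.1).

Definition unconsc (n : nat) (v : 'cV[R]_n.+1) : measurableTypeR R * 'cV[R]_n :=
  (v ord0 0, \col_j v (lift ord0 j) 0).

Lemma conscK (n : nat) : cancel (@consc n) (@unconsc n).
Proof.
move=> [x v]; rewrite /unconsc !mxE unlift_none; congr pair.
by apply/matrixP => i j; rewrite !mxE liftK (ord1 j).
Qed.

Lemma measurable_consc (n : nat) : measurable_fun setT (@consc n).
Proof.
apply/measurable_fun_mxP => i j; rewrite /consc.
case: (unliftP ord0 i) => [k ->|->].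
  under eq_fun do rewrite mxE liftK.
  exact: (measurableT_comp (measurable_mx_entry k 0) measurable_snd).
under eq_fun do rewrite mxE unlift_none.
exact: measurable_fst.
Qed.

Lemma measurable_unconsc (n : nat) : measurable_fun setT (@unconsc n).
Proof.
apply/measurable_fun_pairP; split; first exact: measurable_mx_entry.
apply/measurable_fun_mxP => i j.
rewrite [X in measurable_fun _ X](_ : _ =
  (fun v : 'cV[R]_n.+1 => v (lift ord0 i) 0)).
  exact: measurable_mx_entry.
by apply/funext => v; rewrite /= !mxE.
Qed.

Section step.
Context (n : nat) (mu : {sigma_finite_measure set 'cV[R]_n -> \bar R}).

Definition lebesgue_cons : set 'cV[R]_n.+1 -> \bar R :=
  pushforward (@lebesgue_measure R \x mu)%E (@consc n).

Let mpre (A : set 'cV[R]_n.+1) : measurable A -> measurable (@consc n @^-1` A).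
Proof. by move=> mA; rewrite -[X in measurable X]setTI; apply: measurable_consc. Qed.

Let lebesgue_cons0 : lebesgue_cons set0 = 0%E.
Proof. by rewrite /lebesgue_cons /pushforward preimage_set0 measure0. Qed.

Let lebesgue_cons_ge0 A : (0 <= lebesgue_cons A)%E.
Proof. by rewrite /lebesgue_cons /pushforward measure_ge0. Qed.

Let lebesgue_cons_sigma_additive : semi_sigma_additive lebesgue_cons.
Proof.
move=> F mF tF mUF; rewrite /lebesgue_cons /pushforward preimage_bigcup.
apply: measure_semi_sigma_additive => [k||].
exact: mpre.
apply/trivIsetP => /= i j _ _ ij; rewrite -preimage_setI.
  by move/trivIsetP : tF => /(_ _ _ _ _ ij) ->//; rewrite preimage_set0.
- by rewrite -preimage_bigcup; exact: mpre.
Qed.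

HB.instance Definition _ := isMeasure.Build _ _ _ lebesgue_cons
  lebesgue_cons0 lebesgue_cons_ge0 lebesgue_cons_sigma_additive.

Let lebesgue_cons_sigma_finite : sigma_finite setT lebesgue_cons.
Proof.
have /sigma_finiteP[F [TF ndF Foo]] := sigma_finiteT (@lebesgue_measure R).
have /sigma_finiteP[G [TG ndG Goo]] := sigma_finiteT mu.
exists (fun k => @unconsc n @^-1` (F k `*` G k)).
  rewrite -preimage_bigcup (_ : \bigcup_k _ = setT) ?preimage_setT//.
  rewrite -subTset => -[x v] _.
  have [i _ Fx] : (\bigcup_i F i) x by rewrite -TF.
  have [j _ Gv] : (\bigcup_j G j) v by rewrite -TG.
  exists (maxn i j) => //; split => /=.
    by move: x Fx; exact/subsetPset/ndF/leq_maxl.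
  by move: v Gv; exact/subsetPset/ndG/leq_maxr.
move=> k; have [mF Fk] := Foo k; have [mG Gk] := Goo k; split.
  rewrite -[X in measurable X]setTI; apply: measurable_unconsc => //.
  exact: measurableX.
rewrite /lebesgue_cons /pushforward -comp_preimage.
rewrite (_ : _ \o _ = id); last by apply/funext => x /=; rewrite conscK.
by rewrite preimage_id product_measure1E// lte_mul_pinfty// ge0_fin_numE.
Qed.

HB.instance Definition _ := Measure_isSigmaFinite.Build _ _ _ lebesgue_cons
  lebesgue_cons_sigma_finite.

End step.

Fixpoint lebesgue_cV (n : nat) : {sigma_finite_measure set 'cV[R]_n -> \bar R} :=
  match n with
  | 0 => \d_(0 : 'cV[R]_0)
  | n'.+1 => lebesgue_cons (lebesgue_cV n')
  end.

Lemma lebesgue_cV_box (n : nat) (A : 'I_n -> set (measurableTypeR R)) :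
  (forall i, measurable (A i)) ->
  lebesgue_cV n [set v | forall i, A i (v i 0)] =
    (\big[mule/1]_(i < n) lebesgue_measure (A i))%E.
Proof.
elim: n A => [|n IHn] A mA /=.
  rewrite big_ord0 diracE (_ : _ \in _ = true)//.
  by apply/mem_set => -[].
rewrite big_ord_recl -IHn//= /lebesgue_cons /pushforward.
have mB : measurable [set v : 'cV[R]_n | forall i, A (lift ord0 i) (v i 0)].
  rewrite (_ : [set _ | _] = \bigcap_(i in [set: 'I_n])
      ((fun v : 'cV[R]_n => v i 0) @^-1` A (lift ord0 i))).
    apply: fin_bigcap_measurable => // i _; rewrite -[X in measurable X]setTI.
    by apply: measurable_mx_entry => //; exact: mA.
  by apply/seteqP; split => v /= Av i; [move=> _|]; exact: Av.
rewrite -product_measure1E//; congr (_ _).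
apply/seteqP; split => -[x v] /=.
  move=> Axv; split=> [|i] /=.
    by have := Axv ord0; rewrite mxE unlift_none.
  by have := Axv (lift ord0 i); rewrite mxE liftK.
move=> [/= Ax Av] i; rewrite mxE.
by case: unliftP => [j ->|->].
Qed.

End lebesgue_cV.

Section conditional_expectation.
Context (R : realType) (d : measure_display) (T : measurableType d)
  (P : probability T R).

Section version.
Context (d' : measure_display) (U : measurableType d').

(* [h] is a version of the regression function [u |-> E[f | V = u]], i.e.
   [h \o V] is a version of [E[f | V]]. *)
Definition is_regression (V : T -> U) (f : T -> R) (h : U -> R) : Prop :=
  [/\ measurable_fun setT h,
      P.-integrable setT (fun w => (h (V w))%:E) &
      forall B : set U, measurable B ->
        (\int[P]_(w in V @^-1` B) (h (V w))%:E =
         \int[P]_(w in V @^-1` B) (f w)%:E)%E].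

Definition regression (V : T -> U) (f : T -> R) : U -> R :=
  xget (cst 0) [set h | is_regression V f h].

Definition cexp (V : T -> U) (f : T -> R) : T -> R := regression V f \o V.

Lemma regressionP (V : T -> U) (f : T -> R) :
  measurable_fun setT V -> P.-integrable setT (EFin \o f) ->
  is_regression V f (regression V f).
Proof.
move=> mV intf; apply: xgetPex.
have mpre (B : set U) : measurable B -> measurable (V @^-1` B).
  by move=> mB; rewrite -[X in measurable X]setTI; exact: mV.
pose V' : {mfun T >-> U} := HB.pack V (isMeasurableFun.Build _ _ _ _ V mV).
pose nu : {charge set U -> \bar R} :=
  measure_function_pushforward__canonical__charge_Charge
    (induced_charge intf) mV.
pose mu : probability U R := distribution P V'.
have numu : nu `<< mu.
  apply/null_content_dominatesP => B mB muB.
  apply: null_set_integral => //.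
    exact: mpre.
  have mf := measurable_int _ intf.
  exact: measurable_funTS.
have hE u : Radon_Nikodym nu mu u = (fine (Radon_Nikodym nu mu u))%:E.
  by rewrite fineK//; exact: Radon_Nikodym_fin_num.
have inth := Radon_Nikodym_integrable numu.
have mh := measurable_int _ inth.
have inthV : P.-integrable setT (Radon_Nikodym nu mu \o V).
  apply/integrableP; split; first exact: (measurableT_comp mh mV).
  move/integrableP : inth => [_]; apply: le_lt_trans.
  rewrite (@ge0_integral_pushforward _ _ _ _ _ V mV P setT)//.
  by apply: (@measurableT_comp _ _ _ U (\bar R) (\bar R) abse).
exists (fine \o Radon_Nikodym nu mu); split.
- exact: (measurableT_comp (fine_measurable _)).
- by apply: eq_integrable inthV => // w _ /=; rewrite -hE.
- move=> B mB.
  transitivity (nu B) => //.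
  rewrite (Radon_Nikodym_integral numu mB).
  rewrite (@integral_pushforward _ _ _ _ _ V mV P B)//; last first.
    by apply: (integrableS measurableT) inthV => //; exact: mpre.
  by apply: eq_integral => w _; rewrite [RHS]/= hE.
Qed.

Definition cexp_mx (V : T -> U) (m n : nat) (F : T -> 'M[R]_(m, n)) (w : T) :
    'M[R]_(m, n) :=
  \matrix_(i, j) cexp V (fun w' => F w' i j) w.

Definition cvar (V : T -> U) (n : nat) (Z : T -> 'cV[R]_n) : T -> 'M[R]_n :=
  cexp_mx V (fun w => (Z w - cexp_mx V Z w) *m (Z w - cexp_mx V Z w)^T).

End version.

Definition mean_mx (m n : nat) (F : T -> 'M[R]_(m, n)) : 'M[R]_(m, n) :=
  \matrix_(i, j) fine 'E_P[fun w => F w i j].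

Definition covariance_mx (n : nat) (X : T -> 'cV[R]_n) : 'M[R]_n :=
  \matrix_(i, j) fine (covariance P (fun w => X w i 0) (fun w => X w j 0)).

Definition cond_indep (d1 d2 d3 : measure_display) (U1 : measurableType d1)
    (U2 : measurableType d2) (U3 : measurableType d3)
    (V1 : T -> U1) (V2 : T -> U2) (V3 : T -> U3) : Prop :=
  forall (A : set U1) (B : set U2), measurable A -> measurable B ->
    {ae P, forall w, cexp V3 \1_(V1 @^-1` A `&` V2 @^-1` B) w =
                     cexp V3 \1_(V1 @^-1` A) w * cexp V3 \1_(V2 @^-1` B) w}.

End conditional_expectation.

Section geometry.
Context (R : realType) (p : nat).
Implicit Types (E : {vspace 'cV[R]_p}) (u v : 'cV[R]_p).

(* The Euclidean norm: the norm [`|v|] on matrices is the sup norm. *)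
Definition enorm v : R := Num.sqrt (\sum_i v i 0 ^+ 2).

Definition colspace (A : 'M[R]_p) : {vspace 'cV[R]_p} :=
  <<[seq col j A | j <- enum 'I_p]>>%VS.

Definition basis_mx E : 'M[R]_(p, \dim E) :=
  \matrix_(i, j) ((vbasis E)`_j : 'cV[R]_p) i 0.

Definition orthproj E : 'M[R]_p :=
  basis_mx E *m invmx ((basis_mx E)^T *m basis_mx E) *m (basis_mx E)^T.

Lemma orthprojP E v :
  orthproj E *m v \in E /\
  (forall u, u \in E -> u^T *m (v - orthproj E *m v) = 0).
Proof.
have BE (c : 'cV[R]_(\dim E)) :
    basis_mx E *m c = \sum_(j < \dim E) c j 0 *: (vbasis E)`_j.
  apply/matrixP => i k; rewrite (ord1 k) mxE summxE.
  by apply: eq_bigr => j _; rewrite !mxE mulrC.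
have BI (c : 'cV[R]_(\dim E)) : basis_mx E *m c = 0 -> c = 0.
  rewrite BE => c0; apply/matrixP => j k; rewrite (ord1 k) [RHS]mxE.
  have /freeP fE := basis_free (vbasisP E).
  exact: fE (fun j => c j 0) c0 j.
have sq0 (n : nat) (c : 'cV[R]_n) : c^T *m c = 0 -> c = 0.
  move=> /matrixP /(_ 0 0); rewrite !mxE => /eqP; rewrite psumr_eq0; last first.
    by move=> i _; rewrite mxE -expr2 sqr_ge0.
  move=> /allP c0; apply/matrixP => i j; rewrite (ord1 j) [RHS]mxE.
  have := c0 i (mem_index_enum _); rewrite mxE -expr2 sqrf_eq0 /=.
  by move/eqP.
have BU : (basis_mx E)^T *m basis_mx E \in unitmx.
  rewrite -row_free_unit; apply: inj_row_free => x x0.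
  apply: trmx_inj; rewrite trmx0; apply: BI; apply: sq0.
  by rewrite trmx_mul trmxK -mulmxA [_^T *m _ in LHS]mulmxA mulmxA x0 mul0mx.
split.
  rewrite /orthproj -!mulmxA BE; apply: rpred_sum => j _; apply: rpredZ.
  by apply: vbasis_mem; rewrite mem_nth// size_tuple.
move=> u uE.
have -> : u = basis_mx E *m (\col_j coord (vbasis E) j u).
  rewrite BE {1}(coord_vbasis uE); apply: eq_bigr => j _; by rewrite mxE.
rewrite trmx_mul -mulmxA mulmxBr [X in _ - X](_ : _ = (basis_mx E)^T *m v).
  by rewrite subrr mulmx0.
by rewrite /orthproj !mulmxA mulmxV// mul1mx.
Qed.

End geometry.

Definition is_invsqrt (R : realType) (p : nat) (A S : 'M[R]_p) : Prop :=
  [/\ S^T = S,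
      forall v : 'cV[R]_p, v != 0 -> 0 < (v^T *m S *m v) 0 0 &
      S *m S = invmx A].

Definition boundary (T : topologicalType) (A : set T) : set T :=
  closure A `\` A°.

(* Closed support of a law; stated on the law and not on a given density, whose
   own closed support may change with the choice of a version. *)
Definition law_support (R : realType) (p : nat) (mu : set 'cV[R]_p -> \bar R) :
    set 'cV[R]_p :=
  [set x | forall U : set 'cV[R]_p, open U -> U x -> (0 < mu U)%E].

Definition has_density (R : realType) (p : nat)
    (mu : set 'cV[R]_p -> \bar R) : Prop :=
  exists f : 'cV[R]_p -> R,
    [/\ measurable_fun setT f, forall x, 0 <= f x &
        forall A : set 'cV[R]_p, measurable A ->
          mu A = (\int[lebesgue_cV R p]_(x in A) (f x)%:E)%E].

Section dimension_reduction.
Context (R : realType) (d : measure_display) (T : measurableType d)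
  (P : probability T R) (p : nat).
Implicit Types (Y : T -> R) (Z X : T -> 'cV[R]_p) (E : {vspace 'cV[R]_p}).

Definition standardize X (S : 'M[R]_p) (w : T) : 'cV[R]_p :=
  S *m (X w - mean_mx P X).

Definition is_DRS Y Z E : Prop :=
  cond_indep P Y Z (fun w => orthproj E *m Z w).

Definition is_central_subspace Y Z E : Prop :=
  [/\ is_DRS Y Z E,
      forall F, is_DRS Y Z F -> F != E -> (\dim E < \dim F)%N &
      forall v, v \in E <-> (forall F, is_DRS Y Z F -> v \in F)].

Section psi_space.
Variables (Y : T -> R) (Z : T -> 'cV[R]_p) (Ec : {vspace 'cV[R]_p}).
Variable psi : R -> R.

Definition psi_matrix : 'M[R]_p :=
  mean_mx P (fun w => psi (Y w) *: (Z w *m (Z w)^T)).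

Definition lambda_star : R :=
  (p - \dim Ec)%:R^-1 *
  fine 'E_P[fun w => enorm ((1%:M - orthproj Ec) *m Z w) ^+ 2 * psi (Y w)].

Definition psi_space : {vspace 'cV[R]_p} :=
  colspace (psi_matrix - lambda_star%:M).

End psi_space.
End dimension_reduction.

Section weighted_L1.
Context (R : realType) (theta : R -> R) (mu : set R -> \bar R).

Definition L1_seminorm (u : R -> R) : \bar R :=
  (\int[mu]_y (`|u y| * theta y)%:E)%E.

Definition in_L1 (u : R -> R) : Prop :=
  measurable_fun setT u /\ (L1_seminorm u < +oo)%E.

Definition lin_span (Psi : set (R -> R)) : set (R -> R) :=
  [set v | exists (n : nat) (c : 'I_n -> R) (g : 'I_n -> R -> R),
     (forall i, Psi (g i)) /\ v = (fun y => \sum_i c i * g i y)].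

Definition total_in_L1 (Psi : set (R -> R)) : Prop :=
  (forall psi, Psi psi -> in_L1 psi) /\
  (forall u, in_L1 u -> forall e : R, 0 < e ->
     exists2 v, lin_span Psi v & (L1_seminorm (u \- v)%R < e%:E)%E).

End weighted_L1.

(* Main.v *)
(* Write V = P_c Z and G(Z) = Z Z^T - |Q_c Z|^2 / (p - d) I, so that
   M_psi - lambda*_psi I = E[psi(Y) G(Z)].  Linearity and the diagonal conditional
   variance give E[G(Z) Q_c | V] = 0; conditional independence of Y and Z given V
   turns this into E[G(Z) Q_c | Y] = 0, so that E[psi(Y) G(Z)] Q_c = 0 and every
   psi-space lies in E_c.  Take a finite subfamily whose sum F of psi-spaces has
   maximal dimension: F contains all psi-spaces.  If F <> E_c, some unit eta in E_c
   is orthogonal to F, so E[psi(Y) eta^T G(Z) eta] = 0 for every psi in Psi.  As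
   |eta^T G(Z) eta| <= C |Z|^2, totality in L_1 extends this to indicators of Borel
   sets, i.e. E[eta^T G(Z) eta | Y] = 0, against the coverage hypothesis. *)
Require Import Defs.
From HB Require Import structures.
From mathcomp Require Import all_boot all_order all_algebra.
From mathcomp Require Import all_classical all_reals all_analysis measurable_realfun.
From mathcomp Require Import lra ring.

Import Order.TTheory GRing.Theory Num.Theory.
Import numFieldNormedType.Exports.

Local Open Scope classical_set_scope.
Local Open Scope ring_scope.

(** * Integrable functions with vanishing conditional mean *)

Section zero_conditional_mean.
Set Implicit Arguments.
Unset Strict Implicit.
Context (R : realType) (d : measure_display) (T : measurableType d)
  (P : probability T R).
Implicit Types f g : T -> R.

Definition integ (f : T -> R) : Prop := P.-integrable setT (EFin \o f).

Lemma integ_measurable f : integ f -> measurable_fun setT f.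
Proof. by move=> /measurable_int /measurable_EFinP. Qed.

Lemma integ_le f g : measurable_fun setT f -> (forall w, `|f w| <= g w) ->
  integ g -> integ f.
Proof.
move=> mf fg; apply: le_integrable => //; first exact/measurable_EFinP.
by move=> w _ /=; rewrite lee_fin (le_trans (fg w))// ler_norm.
Qed.

Lemma integD f g : integ f -> integ g -> integ (fun w => f w + g w).
Proof. by move=> fi gi; exact: (integrableD measurableT fi gi). Qed.

Lemma integZ k f : integ f -> integ (fun w => k * f w).
Proof. by move=> fi; exact: (integrableZl measurableT k fi). Qed.

Lemma integB f g : integ f -> integ g -> integ (fun w => f w - g w).
Proof. by move=> fi gi; exact: (integrableB measurableT fi gi). Qed.

Lemma integ_sum (I : Type) (s : seq I) (f : I -> T -> R) :
  (forall i, integ (f i)) -> integ (fun w => \sum_(i <- s) f i w).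
Proof.
move=> fi; elim: s => [|i s IHs].
  by under eq_fun do rewrite big_nil; exact: finite_measure_integrable_cst.
by under eq_fun do rewrite big_cons; exact: integD.
Qed.

Lemma integ_abs f : integ f -> integ (fun w => `|f w|).
Proof. exact: integrable_norm. Qed.

Lemma integ_ae f g : measurable_fun setT g -> integ f ->
  {ae P, forall w, f w = g w} -> integ g.
Proof.
move=> mg /integrableP[mf fi] fg; apply/integrableP; split.
  exact/measurable_EFinP.
rewrite (le_lt_trans _ fi)//; apply: ae_ge0_le_integral => //.
- by apply: measurableT_comp => //; exact/measurable_EFinP.
- exact: measurableT_comp.
- by apply: filterS fg => w + _ /= => ->.
Qed.

Section given.
Context (d' : measure_display) (U : measurableType d') (V : T -> U).
Hypothesis mV : measurable_fun setT V.
Implicit Types phi : U -> R.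

Let mpre (B : set U) : measurable B -> measurable (V @^-1` B).
Proof. by move=> mB; rewrite -[X in measurable X]setTI; exact: mV. Qed.

Import HBNNSimple.

Lemma integral_preimage f (B : set U) :
  (\int[P]_(w in V @^-1` B) (f w)%:E = \int[P]_w (f w * \1_B (V w))%:E)%E.
Proof.
rewrite integral_mkcond; apply: eq_integral => w _.
rewrite patchE indicE/=; case: ifPn => [/set_mem wy|wy].
  by rewrite mem_set ?mulr1.
rewrite memNset ?mulr0// => yw.
by move/negP : wy; apply; exact: mem_set.
Qed.

(** Equality on the events of [V] extends by linearity to simple functions of [V], and by monotone
    convergence along [nnsfun_approx] to every nonnegative measurable [phi]. *)
Lemma eq_ge0_integral_comp f g phi :
  measurable_fun setT f -> (forall w, 0 <= f w) ->
  measurable_fun setT g -> (forall w, 0 <= g w) ->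
  measurable_fun setT phi -> (forall u, 0 <= phi u) ->
  (forall B, measurable B ->
    (\int[P]_(w in V @^-1` B) (f w)%:E = \int[P]_(w in V @^-1` B) (g w)%:E)%E) ->
  (\int[P]_w (f w * phi (V w))%:E = \int[P]_w (g w * phi (V w))%:E)%E.
Proof.
move=> mf f0 mg g0 mphi phi0 fg.
have mphi' : measurable_fun setT (EFin \o phi) by exact/measurable_EFinP.
pose h := nnsfun_approx measurableT mphi'.
have mh n : measurable_fun setT (fun w => h n (V w)).
  exact: measurableT_comp.
have limE (k : T -> R) : measurable_fun setT k -> (forall w, 0 <= k w) ->
    (\int[P]_w (k w * phi (V w))%:E =
     limn (fun n => \int[P]_w (k w * h n (V w))%:E))%E.
  move=> mk k0.
  rewrite -monotone_convergence//.
  - apply: eq_integral => w _; apply/esym/cvg_lim => //.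
    under eq_fun do rewrite EFinM.
    rewrite EFinM; apply: cvgeZl => //.
    apply: (@cvg_nnsfun_approx _ _ _ _ measurableT _ mphi') => //= u _.
    by rewrite lee_fin.
  - by move=> n; apply/measurable_EFinP; exact: measurable_funM.
  - by move=> n w _; rewrite lee_fin mulr_ge0.
  - move=> w _ a b ab; rewrite lee_fin ler_wpM2l//.
    exact/lefP/(nd_nnsfun_approx measurableT mphi').
rewrite !limE//; congr (limn _); apply/funext => n.
have sumE (k : T -> R) : measurable_fun setT k -> (forall w, 0 <= k w) ->
    (\int[P]_w (k w * h n (V w))%:E =
     \sum_(y \in range (h n))
        y%:E * \int[P]_(w in V @^-1` (h n @^-1` [set y])) (k w)%:E)%E.
  move=> mk k0.
  have mB y : measurable (h n @^-1` [set y]) by exact: measurable_funPTI.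
  transitivity (\int[P]_w (\sum_(y \in range (h n))
      (y * (k w * \1_(h n @^-1` [set y]) (V w)))%:E))%E.
    apply: eq_integral => w _; rewrite (fimfunE (h n)) mulr_fsumr -fsumEFin//.
    by apply: eq_fsbigr => y _; rewrite mulrCA.
  have mk1 y : measurable_fun setT
      (fun w => k w * \1_(h n @^-1` [set y]) (V w)).
    by apply: measurable_funM => //; exact: measurableT_comp.
  have k10 y w : 0 <= k w * \1_(h n @^-1` [set y]) (V w).
    by rewrite mulr_ge0.
  rewrite ge0_integral_fsum//.
  - apply: eq_fsbigr => y; rewrite inE => -[u _ <-].
    under eq_integral do rewrite EFinM.
    rewrite ge0_integralZl_EFin//.
    + by rewrite integral_preimage.
    + by move=> w _; rewrite lee_fin.
    + exact/measurable_EFinP.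
  - by move=> y; apply/measurable_EFinP; exact: measurable_funM.
  (* Nonnegativity is asked for every real [y]; one outside the range of [h n] may be negative, but
     then its indicator vanishes. *)
  - move=> y w _; rewrite lee_fin.
    have [[u _ <-]|yn] := pselect (range (h n) y); first by rewrite mulr_ge0.
    by rewrite indicE memNset ?mulr0// => /= hy; apply: yn; exists (V w).
by rewrite !sumE//; apply: eq_fsbigr => y _; rewrite fg.
Qed.

(* [E[f | V] = 0], stated without reference to a version of [E[f | V]]. *)
Definition zmean f : Prop :=
  integ f /\ forall B, measurable B -> (\int[P]_(w in V @^-1` B) (f w)%:E = 0)%E.

Let integS B f : measurable B -> integ f -> P.-integrable (V @^-1` B) (EFin \o f).
Proof. by move=> mB; apply: integrableS => //; exact: mpre. Qed.

Lemma zmeanD f g : zmean f -> zmean g -> zmean (fun w => f w + g w).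
Proof.
move=> [fi f0] [gi g0]; split; first exact: integD.
move=> B mB; rewrite (@integralD_EFin _ _ _ P _ (mpre mB) f g)//.
- by rewrite f0// g0// adde0.
- exact: integS.
- exact: integS.
Qed.

Lemma zmeanZ k f : zmean f -> zmean (fun w => k * f w).
Proof.
move=> [fi f0]; split; first exact: integZ.
move=> B mB; under eq_integral do rewrite EFinM.
rewrite integralZl//; [by rewrite f0// mule0|exact: mpre|exact: integS].
Qed.

Lemma zmeanB f g : zmean f -> zmean g -> zmean (fun w => f w - g w).
Proof.
move=> fz gz; have := zmeanD fz (zmeanZ (-1) gz).
by under eq_fun do rewrite mulN1r.
Qed.

Lemma zmean_sum (I : Type) (s : seq I) (f : I -> T -> R) :
  (forall i, zmean (f i)) -> zmean (fun w => \sum_(i <- s) f i w).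
Proof.
move=> fz; elim: s => [|i s IHs].
  under eq_fun do rewrite big_nil; split=> [|B mB].
    exact: finite_measure_integrable_cst.
  by rewrite integral0.
by under eq_fun do rewrite big_cons; exact: zmeanD.
Qed.

Lemma zmean_ae f g : measurable_fun setT g -> {ae P, forall w, f w = g w} ->
  zmean f -> zmean g.
Proof.
move=> mg fg [fi f0]; split; first exact: integ_ae fg.
move=> B mB; rewrite -(f0 B mB); apply: ae_eq_integral.
- exact: mpre.
- by apply: measurable_funTS; exact/measurable_EFinP.
- by apply: measurable_funTS; exact/measurable_EFinP/integ_measurable.
- by apply: filterS fg => w /= ->.
Qed.

(** The positive and negative parts of [f] have equal integrals on the events of [V], so
    [eq_ge0_integral_comp] settles the case of a nonnegative factor; the general [phi] is then split
    into its own two parts. *)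
Lemma zmean_int0 f phi : zmean f -> measurable_fun setT phi ->
  integ (fun w => f w * phi (V w)) -> (\int[P]_w (f w * phi (V w))%:E = 0)%E.
Proof.
move=> [fi f0].
have partE (x : R) : x = Num.max x 0 - Num.max (- x) 0.
  by case: (lerP x 0) => x0; case: (lerP (- x) 0) => x0'; lra.
have part_le (x : R) : (0 <= Num.max x 0) * (Num.max x 0 <= `|x|).
  by rewrite le_max lexx orbT ge_max ler_norm normr_ge0.
have partN_le (x : R) : (0 <= Num.max (- x) 0) * (Num.max (- x) 0 <= `|x|).
  by rewrite -(normrN x); exact: part_le.
have mpart d1 (W : measurableType d1) (k : W -> R) : measurable_fun setT k ->
    measurable_fun setT (fun w => Num.max (k w) 0) /\
    measurable_fun setT (fun w => Num.max (- k w) 0).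
  move=> mk; split; apply: measurable_maxr => //; exact: measurableT_comp.
have mf := integ_measurable fi.
have [mfp mfn] := mpart _ _ _ mf.
have fpi : integ (fun w => Num.max (f w) 0).
  apply: integ_le (integ_abs fi) => // w.
  by rewrite ger0_norm !part_le.
have fni : integ (fun w => Num.max (- f w) 0).
  apply: integ_le (integ_abs fi) => // w.
  by rewrite ger0_norm !partN_le.
have eqpn B : measurable B -> (\int[P]_(w in V @^-1` B) (Num.max (f w) 0)%:E =
    \int[P]_(w in V @^-1` B) (Num.max (- f w) 0)%:E)%E.
  move=> mB; have := f0 B mB.
  under eq_integral do rewrite (partE (f _)).
  rewrite (@integralB_EFin _ _ _ P _ _ _ (mpre mB) (integS mB fpi) (integS mB fni)).
  have finp := integrable_fin_num (mpre mB) (integS mB fpi).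
  have finn := integrable_fin_num (mpre mB) (integS mB fni).
  by move/eqP; rewrite sube_eq ?fin_num_adde_defl//= add0e => /eqP.
have ge0_case (psi : U -> R) : measurable_fun setT psi ->
    (forall u, 0 <= psi u) -> integ (fun w => f w * psi (V w)) ->
    (\int[P]_w (f w * psi (V w))%:E = 0)%E.
  move=> mpsi psi0 fpsi.
  have mpsiV : measurable_fun setT (psi \o V) by exact: measurableT_comp.
  under eq_integral do rewrite (partE (f _)) mulrBl.
  have i1 : integ (fun w => Num.max (f w) 0 * psi (V w)).
    apply: integ_le (integ_abs fpsi); first exact: measurable_funM.
    by move=> w; rewrite !normrM ler_wpM2r// ger0_norm part_le.
  have i2 : integ (fun w => Num.max (- f w) 0 * psi (V w)).
    apply: integ_le (integ_abs fpsi); first exact: measurable_funM.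
    by move=> w; rewrite !normrM ler_wpM2r// ger0_norm partN_le.
  rewrite (@integralB_EFin _ _ _ P _ _ _ measurableT i1 i2).
  rewrite (@eq_ge0_integral_comp _ (fun w => Num.max (- f w) 0))//.
  - by rewrite subee//; exact: (integrable_fin_num measurableT i2).
  - by move=> w; rewrite part_le.
  - by move=> w; rewrite partN_le.
move=> mphi fphi; have [mp mn] := mpart _ _ _ mphi.
under eq_integral do rewrite (partE (phi _)) mulrBr.
have i1 : integ (fun w => f w * Num.max (phi (V w)) 0).
  apply: integ_le (integ_abs fphi).
    by apply: measurable_funM => //; exact: (measurableT_comp mp).
  by move=> w; rewrite !normrM ler_wpM2l// ger0_norm part_le.
have i2 : integ (fun w => f w * Num.max (- phi (V w)) 0).
  apply: integ_le (integ_abs fphi).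
    by apply: measurable_funM => //; exact: (measurableT_comp mn).
  by move=> w; rewrite !normrM ler_wpM2l// ger0_norm partN_le.
rewrite (@integralB_EFin _ _ _ P _ _ _ measurableT i1 i2).
rewrite (ge0_case (fun u => Num.max (phi u) 0))//; last by move=> u; rewrite part_le.
rewrite (ge0_case (fun u => Num.max (- phi u) 0)) ?sube0//.
by move=> u; rewrite partN_le.
Qed.

(** The indicator of an event of [V] can be absorbed into the factor [phi], so [zmean_int0] applies
    event by event. *)
Lemma zmean_mul f phi : zmean f -> measurable_fun setT phi ->
  integ (fun w => f w * phi (V w)) -> zmean (fun w => f w * phi (V w)).
Proof.
move=> fz mphi fphi; split=> // B mB.
have m1 : measurable_fun setT (fun u => phi u * \1_B u).
  by apply: measurable_funM => //; exact: measurable_indic.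
have le1 w : `|f w * (phi (V w) * \1_B (V w))| <= `|f w * phi (V w)|.
  by rewrite mulrA normrM ler_piMr// ger0_norm// indicE lern1 leq_b1.
have i1 : integ (fun w => f w * (phi (V w) * \1_B (V w))).
  apply: (integ_le _ le1 (integ_abs fphi)).
  apply: measurable_funM; first exact: (integ_measurable fz.1).
  exact: (measurableT_comp m1).
rewrite integral_preimage -[RHS](zmean_int0 fz m1 i1).
by apply: eq_integral => w _; rewrite mulrA.
Qed.

(** Testing against the sign [s] of [phi] gives a zero integral for the absolute value. This serves
    as uniqueness of conditional expectations. *)
Lemma zmean_comp_ae0 phi : measurable_fun setT phi -> zmean (phi \o V) ->
  {ae P, forall w, phi (V w) = 0}.
Proof.
move=> mphi pz; pose s u : R := (-1) ^+ (phi u < 0)%R.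
have ms : measurable_fun setT s.
  have -> : s = (fun u => 1 - 2 * \1_[set u | phi u < 0] u).
    apply/funext => u; rewrite /s indicE.
    have [u0|u0] := ltP (phi u) 0.
      by rewrite mem_set//= expr1; lra.
    rewrite memNset ?expr0 ?mulr0 ?subr0//=.
    by apply/negP; rewrite -leNgt.
  apply: measurable_funB => //; apply: measurable_funM => //.
  apply: measurable_indic; rewrite -[X in measurable X]setTI.
  have -> : [set u | phi u < 0] = phi @^-1` `]-oo, 0[%classic.
    by apply/seteqP; split => u /=; rewrite in_itv.
  exact: mphi.
have sE w : (phi \o V) w * s (V w) = `|phi (V w)|.
  by rewrite /s/= mulrC -normrEsign.
have si : integ (fun w => (phi \o V) w * s (V w)).
  by under eq_fun do rewrite sE; exact: integ_abs pz.1.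
have := zmean_int0 pz ms si; under eq_integral do rewrite sE.
have mpV : measurable_fun setT (EFin \o (phi \o V)).
  by apply/measurable_EFinP; exact: measurableT_comp.
move=> /(ae_eq_integral_abs P measurableT mpV).1.
by apply: filterS => w /= /(_ Logic.I) [].
Qed.

Lemma zmean_cexp f : integ f -> zmean (fun w => f w - cexp P V f w).
Proof.
move=> fi; have [mh hi hE] := regressionP mV fi.
split=> [|B mB]; first exact: integB.
rewrite (@integralB_EFin _ _ _ P _ _ _ (mpre mB) (integS mB fi) (integS mB hi)).
rewrite -hE// subee//.
exact: (integrable_fin_num (mpre mB) (integS mB hi)).
Qed.

Lemma integ_cexp f : integ f -> integ (cexp P V f).
Proof. by move=> fi; have [] := regressionP mV fi. Qed.

(** On the event where [phi (V w)] is negative, [f - phi \o V] is positive with zero integral. It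
    therefore vanishes almost everywhere there, which forces [phi (V w) = f w >= 0], so the event is
    null. *)
Lemma zmean_ge0 f phi : measurable_fun setT phi -> integ (phi \o V) ->
  (forall w, 0 <= f w) ->
  zmean (fun w => f w - phi (V w)) -> {ae P, forall w, 0 <= phi (V w)}.
Proof.
move=> mphi phii f0 fz.
have mfz := integ_measurable fz.1.
pose B := phi @^-1` `]-oo, 0[%classic.
have mB : measurable B by rewrite -[X in measurable X]setTI; exact: mphi.
have := fz.2 _ mB.
rewrite integral_mkcond => int0.
have gE : {ae P, forall w, [set: T] w ->
    (((fun w => (f w - phi (V w))%:E) \_ (V @^-1` B)) w = 0)%E}.
  apply/(ae_eq_integral_abs P measurableT) => //.
    apply/(measurable_restrictT _ (mpre mB)).1; apply: measurable_funTS.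
    exact/measurable_EFinP.
  rewrite -int0; apply: eq_integral => w _; rewrite gee0_abs// patchE.
  case: ifPn => // /set_mem; rewrite /B/= in_itv/= => pV0.
  by rewrite lee_fin subr_ge0 (le_trans (ltW pV0)).
apply: filterS gE => w /(_ Logic.I).
rewrite patchE; case: ifPn => [/set_mem|/negP nB _].
  rewrite /B/= in_itv/= => pV0 [] /eqP; rewrite subr_eq0 => /eqP fE.
  by rewrite -fE.
rewrite leNgt; apply/negP => pV0; apply: nB; apply/mem_set.
by rewrite /B/= in_itv.
Qed.

End given.
End zero_conditional_mean.

(** * Conditional probabilities and conditional independence *)

Section conditional_independence.
Set Implicit Arguments.
Unset Strict Implicit.
Context (R : realType) (d : measure_display) (T : measurableType d)
  (P : probability T R).
Implicit Types f g : T -> R.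

Lemma integ_indic (A : set T) : measurable A -> integ P \1_A.
Proof.
move=> mA; apply: (@integ_le _ _ _ P _ (cst 1)).
- exact: measurable_indic.
- by move=> w; rewrite indicE ger0_norm// lern1 leq_b1.
- exact: finite_measure_integrable_cst.
Qed.

Section given.
Context (d' : measure_display) (U : measurableType d') (V : T -> U).
Hypothesis mV : measurable_fun setT V.

Let mpre (B : set U) : measurable B -> measurable (V @^-1` B).
Proof. by move=> mB; rewrite -[X in measurable X]setTI; exact: mV. Qed.

Lemma zmean_integral0 f : zmean P V f -> (\int[P]_w (f w)%:E = 0)%E.
Proof. by move=> [_ /(_ _ measurableT)]; rewrite preimage_setT. Qed.

Lemma measurable_regression f : integ P f ->
  measurable_fun setT (regression P V f).
Proof. by move=> fi; have [] := regressionP mV fi. Qed.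

Lemma cexp_ge0 f : integ P f -> (forall w, 0 <= f w) ->
  {ae P, forall w, 0 <= cexp P V f w}.
Proof.
move=> fi f0; apply: (zmean_ge0 mV (measurable_regression fi)) f0 _.
  exact: integ_cexp.
exact: zmean_cexp.
Qed.

(** The chosen version of [E[f | V]] is nonnegative only almost everywhere; truncating it at 0 meets
    the sign condition of [eq_ge0_integral_comp] without changing any integral. *)
Lemma ge0_integral_cexp f (phi : U -> R) :
  integ P f -> (forall w, 0 <= f w) ->
  measurable_fun setT phi -> (forall u, 0 <= phi u) ->
  (\int[P]_w (f w * phi (V w))%:E =
   \int[P]_w (Num.max (cexp P V f w) 0 * phi (V w))%:E)%E.
Proof.
move=> fi f0 mphi phi0.
have mc := integ_measurable (integ_cexp mV fi).
have mc0 : measurable_fun setT (fun w => Num.max (cexp P V f w) 0).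
  exact: measurable_maxr.
apply: eq_ge0_integral_comp => //.
- exact: integ_measurable fi.
- by move=> w; rewrite le_max lexx orbT.
move=> B mB.
have [_ _ /(_ _ mB) <-] := regressionP mV fi.
apply: ae_eq_integral.
- exact: mpre.
- by apply: measurable_funTS; exact/measurable_EFinP.
- by apply: measurable_funTS; exact/measurable_EFinP.
by apply: filterS (cexp_ge0 fi f0) => w c0 _; rewrite max_l.
Qed.

(** Clamping the regression function to the unit interval changes it only on a null event, by
    [zmean_ge0] applied to the indicators of [A] and of its complement. Bounds valid everywhere keep
    products with [a (V w)] integrable. *)
Lemma cond_prob_version (A : set T) : measurable A ->
  exists a : U -> R, [/\ measurable_fun setT a, forall u, 0 <= a u <= 1,
    {ae P, forall w, cexp P V \1_A w = a (V w)} &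
    zmean P V (fun w => \1_A w - a (V w))].
Proof.
move=> mA; have Ai := integ_indic mA.
have mr := measurable_regression Ai.
have c0 : {ae P, forall w, 0 <= cexp P V \1_A w}.
  by apply: cexp_ge0 => // w; rewrite indicE.
have c1 : {ae P, forall w, 0 <= 1 - cexp P V \1_A w}.
  have one : integ P (cst 1) by exact: finite_measure_integrable_cst.
  apply: (@zmean_ge0 _ _ _ P _ _ _ mV (fun w => 1 - \1_A w)
    (fun u => 1 - regression P V \1_A u)).
  - exact: measurable_funB.
  - exact: (integB one (integ_cexp mV Ai)).
  - by move=> w; rewrite subr_ge0 indicE lern1 leq_b1.
  - have := zmeanZ mV (-1) (zmean_cexp mV Ai).
    by congr (zmean _ _ _); apply/funext => w; rewrite /cexp/=; ring.
pose a u := Num.min (Num.max (regression P V \1_A u) 0) 1.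
have ma : measurable_fun setT a.
  by apply: measurable_minr => //; exact: measurable_maxr.
have aE : {ae P, forall w, cexp P V \1_A w = a (V w)}.
  apply: filterS2 c0 c1 => w; rewrite /cexp/= /a subr_ge0 => c0 c1.
  by rewrite max_l// min_l.
exists a; split => //.
  by move=> u; rewrite le_min ge_min lexx orbT le_max lexx orbT ler01.
apply: zmean_ae (zmean_cexp mV Ai) => //.
  apply: measurable_funB; first exact: measurable_indic.
  exact: measurableT_comp.
by apply: filterS aE => w ->.
Qed.

End given.

Lemma zmean_cond_indep (d1 d2 d3 : measure_display) (U1 : measurableType d1)
    (U2 : measurableType d2) (U3 : measurableType d3)
    (Y : T -> U1) (W : T -> U2) (m : U2 -> U3) (g : U2 -> R) :
  measurable_fun setT Y -> measurable_fun setT W -> measurable_fun setT m ->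
  measurable_fun setT g -> cond_indep P Y W (fun w => m (W w)) ->
  zmean P (fun w => m (W w)) (fun w => g (W w)) ->
  zmean P Y (fun w => g (W w)).
Proof.
move=> mY mW mm mg indep gz; pose V w := m (W w).
have mV : measurable_fun setT V by exact: measurableT_comp.
have mgW : measurable_fun setT (fun w => g (W w)) by exact: measurableT_comp.
split=> [|A mA]; first exact: gz.1.
have mYA : measurable (Y @^-1` A) by rewrite -[X in measurable X]setTI; exact: mY.
have [a [ma a01 aE az]] := cond_prob_version mV mYA.
have maV : measurable_fun setT (fun w => a (V w)) by exact: measurableT_comp.
pose F w := \1_(Y @^-1` A) w - a (V w).
have mF : measurable_fun setT F by exact: integ_measurable az.1.
(* Given V, conditional independence says that F is uncorrelated with all events
   of W; as V is a function of W, F has zero mean even given W. *)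
have Fz : zmean P W F.
  split=> [|B mB]; first exact: az.1.
  have mWB : measurable (W @^-1` B).
    by rewrite -[X in measurable X]setTI; exact: mW.
  have [b [mb b01 bE bz]] := cond_prob_version mV mWB.
  have mAB := measurableI _ _ mYA mWB.
  have [c [mc c01 cE cz]] := cond_prob_version mV mAB.
  rewrite integral_preimage; apply: (@zmean_integral0 _ _ V).
  have z2 : zmean P V (fun w => c (V w) - a (V w) * b (V w)).
    (* [z0] concerns the zero function, to which [c - a b] is almost everywhere equal by conditional
       independence. *)
    have z0 := zmeanB mV cz cz; apply: zmean_ae z0 => //.
      apply: measurable_funB; first exact: measurableT_comp.
      by apply: measurable_funM => //; exact: measurableT_comp.
    have abE : {ae P, forall w,
        cexp P V \1_(Y @^-1` A `&` W @^-1` B) w = a (V w) * b (V w)}.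
      by apply: filterS3 (indep A B mA mB) aE bE => w -> <- <-.
    by apply: filterS2 abE cE => w -> <-; rewrite !subrr.
  have z3 : zmean P V (fun w => (\1_(W @^-1` B) w - b (V w)) * a (V w)).
    apply: zmean_mul => //.
    apply: integ_le (integ_abs bz.1) => //.
      by apply: measurable_funM => //; exact: integ_measurable bz.1.
    move=> w; rewrite normrM ler_piMr// ger0_norm; first by case/andP: (a01 (V w)).
    by case/andP: (a01 (V w)).
  (* On the event of [B], [F] decomposes as [1_AB - a 1_B = (1_AB - c) + (c - a b) - (1_B - b)
     a]. *)
  have := zmeanB mV (zmeanD mV cz z2) z3.
  congr (zmean _ _ _); apply/funext => w.
  rewrite /F indicI /= [\1_B (W w)](_ : _ = \1_(W @^-1` B) w)//.
  by ring.
have F1 w : `|F w| <= 1.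
  rewrite /F indicE ler_norml; have /andP[] := a01 (V w).
  by case: (_ \in _) => /=; lra.
have Fgi : integ P (fun w => F w * g (W w)).
  apply: integ_le (integ_abs gz.1) => //; first exact: measurable_funM.
  by move=> w; rewrite normrM ler_piMl.
have gai : integ P (fun w => g (W w) * a (V w)).
  apply: integ_le (integ_abs gz.1) => //; first exact: measurable_funM.
  move=> w; rewrite normrM ler_piMr// ger0_norm; first by case/andP: (a01 (V w)).
  by case/andP: (a01 (V w)).
have z1 := zmean_mul mW Fz mg Fgi.
have z2 := zmean_mul mV gz ma gai.
rewrite integral_preimage.
transitivity (\int[P]_w (F w * g (W w) + g (W w) * a (V w))%:E)%E.
  apply: eq_integral => w _; congr EFin; rewrite /F.
  rewrite [\1_A (Y w)](_ : _ = \1_(Y @^-1` A) w)//.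
  by ring.
rewrite (@integralD_EFin _ _ _ P _ measurableT _ _ Fgi gai).
by rewrite (zmean_integral0 z1) (zmean_integral0 z2) adde0.
Qed.

(** A change of variables and the pull-out property turn the weighted seminorm over the law of [Y]
    into an expectation on the probability space, where all later estimates are made. *)
Lemma L1_seminorm_regression (Y : {RV P >-> R}) f (u : R -> R) :
  integ P f -> (forall w, 0 <= f w) -> measurable_fun setT u ->
  L1_seminorm (regression P Y f) (distribution P Y) u =
  (\int[P]_w (f w * `|u (Y w)|)%:E)%E.
Proof.
move=> fi f0 mu.
have mY : measurable_fun setT Y by [].
have mr := measurable_regression mY fi.
rewrite (ge0_integral_cexp mY fi f0 (phi := fun y => `|u y|))//; last first.
  exact: measurableT_comp.
have mr0 : measurable_fun setT (fun y => Num.max (regression P Y f y) 0).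
  exact: measurable_maxr.
have mg : measurable_fun setT
    (fun y => (Num.max (regression P Y f y) 0 * `|u y|)%:E).
  by apply/measurable_EFinP; apply: measurable_funM => //; exact: measurableT_comp.
rewrite -(@ge0_integral_distribution _ _ _ _ _ P Y
  (fun y => (Num.max (regression P Y f y) 0 * `|u y|)%:E))//; last first.
  by move=> y; rewrite lee_fin mulr_ge0// le_max lexx orbT.
apply: ae_eq_integral => //.
  apply/measurable_EFinP; apply: measurable_funM => //; exact: measurableT_comp.
have [N [mN PN sN]] := cexp_ge0 mY fi f0.
(* The weight differs from its truncation only on [B], which the law of [Y] does not charge. *)
pose B := regression P Y f @^-1` `]-oo, 0[%classic.
have mB : measurable B by rewrite -[X in measurable X]setTI; exact: mr.
exists B; split => //.
  apply/eqP; rewrite eq_le measure_ge0 andbT -PN.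
  apply: (@le_measure _ _ _ P (Y @^-1` B)); rewrite ?inE//.
    by rewrite -[X in measurable X]setTI; exact: mY.
  by apply: subset_trans sN => w; rewrite /B/= in_itv/= => h /=; rewrite leNgt h.
move=> y /= h; rewrite /B/= in_itv/= ltNge; apply/negP => r0; apply: h => _.
by rewrite max_l// mulrC.
Qed.

End conditional_independence.

(** * Subspaces and orthogonal projections *)

Section subspace_sums.
Set Implicit Arguments.
Unset Strict Implicit.
Context (K : fieldType) (V : vectType K) (I : choiceType) (f : I -> {vspace V}).

Let S (D : set I) : {vspace V} := (\big[addv/0%VS]_(i \in D) f i)%VS.

Lemma fsumv_supP (D : set I) : finite_set D ->
  (forall i, D i -> (f i <= S D)%VS) /\
  (forall E, (forall i, D i -> (f i <= E)%VS) -> (S D <= E)%VS).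
Proof.
move=> /finite_seqP[s ->]; rewrite /S.
(* Removing duplicates makes the sum over the finite set a sum over a sequence. *)
have -> : [set` s] = [set` undup s].
  by apply/seteqP; split=> i /=; rewrite mem_undup.
rewrite -fsbig_seq ?undup_uniq//; split=> [i /= iD|E DE].
  by rewrite (big_rem i iD)/= addvSl.
rewrite big_seq; apply: (big_ind (fun W => (W <= E)%VS)) => [|A B AE BE|i /DE//].
  exact: sub0v.
by rewrite subv_add AE.
Qed.

(** The dimensions of the finite sums are bounded by that of the ambient space. At a maximum,
    adjoining one more index enlarges the sum without raising its dimension, hence leaves it
    unchanged. *)
Lemma finite_fsumv_sup (A : set I) : exists D : set I,
  [/\ finite_set D, D `<=` A & forall i, A i -> (f i <= S D)%VS].
Proof.
pose Q n := `[< exists D, [/\ finite_set D, D `<=` A & \dim (S D) = n] >].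
have exQ : exists n, Q n.
  by exists (\dim (S set0)); apply/asboolP; exists set0; split.
have ubQ n : Q n -> (n <= \dim {:V})%N.
  by move=> /asboolP[D [_ _ <-]]; exact: dimvS (subvf _).
case: (ex_maxnP exQ ubQ) => n /asboolP[D [fD DA Dn]] maxn.
exists D; split=> // i Ai; pose D' := i |` D.
have fD' : finite_set D' by rewrite finite_setU; split.
have [subD' _] := fsumv_supP fD'; have [_ supD] := fsumv_supP fD.
have SS : (S D <= S D')%VS by apply: supD => j Dj; apply: subD'; right.
have dS : (\dim (S D') <= \dim (S D))%N.
  rewrite Dn; apply: maxn; apply/asboolP; exists D'; split=> //.
  by move=> j [->|/DA].
have /eqP -> : S D == S D' by rewrite eqEdim SS.
by apply: subD'; left.
Qed.

End subspace_sums.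

Section orthogonal_projection.
Set Implicit Arguments.
Unset Strict Implicit.
Context (R : realType) (p : nat).
Implicit Types (E F : {vspace 'cV[R]_p}) (u v x : 'cV[R]_p).

Lemma enorm2 v : enorm v ^+ 2 = \sum_i v i 0 ^+ 2.
Proof. by rewrite sqr_sqrtr// sumr_ge0// => i _; rewrite sqr_ge0. Qed.

Lemma enorm2_eq0 v : enorm v ^+ 2 = 0 -> v = 0.
Proof.
rewrite enorm2 => /eqP; rewrite psumr_eq0; last by move=> i _; rewrite sqr_ge0.
move=> /allP v0; apply/matrixP => i j; rewrite (ord1 j) [RHS]mxE.
by have := v0 i (mem_index_enum _); rewrite sqrf_eq0 /= => /eqP.
Qed.

Lemma entry_le_enorm v i j : v i j ^+ 2 <= enorm v ^+ 2.
Proof.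
rewrite (ord1 j) enorm2 (bigD1 i)//= lerDl sumr_ge0// => k _.
by rewrite sqr_ge0.
Qed.

Lemma tr_mul_enorm v : (v^T *m v) 0 0 = enorm v ^+ 2.
Proof. by rewrite enorm2 mxE; apply: eq_bigr => i _; rewrite mxE -expr2. Qed.

(** The residual lies in [E] and is orthogonal to [E], hence to itself. *)
Lemma orthproj_id E v : v \in E -> orthproj E *m v = v.
Proof.
move=> vE; have [PvE orth] := orthprojP E v.
have := orth _ (rpredB vE PvE) => /matrixP/(_ 0 0).
rewrite tr_mul_enorm [RHS]mxE => /enorm2_eq0/eqP.
by rewrite subr_eq0 => /eqP.
Qed.

Lemma mulmx_cV_inj (m n : nat) (A B : 'M[R]_(m, n)) :
  (forall v : 'cV[R]_n, A *m v = B *m v) -> A = B.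
Proof.
move=> AB; apply/matrixP => i j; have /matrixP/(_ i 0) := AB (delta_mx j 0).
by rewrite -!colE !mxE.
Qed.

Lemma orthproj_idem E : orthproj E *m orthproj E = orthproj E.
Proof.
apply: mulmx_cV_inj => v; rewrite -mulmxA orthproj_id//.
by have [] := orthprojP E v.
Qed.

Lemma trmx_orthproj E : (orthproj E)^T = orthproj E.
Proof. by rewrite /orthproj !trmx_mul trmx_inv trmx_mul !trmxK mulmxA. Qed.

Lemma basis_mx_mul E (c : 'cV[R]_(\dim E)) :
  basis_mx E *m c = \sum_(j < \dim E) c j 0 *: (vbasis E)`_j.
Proof.
apply/matrixP => i k; rewrite (ord1 k) mxE summxE.
by apply: eq_bigr => j _; rewrite !mxE mulrC.
Qed.

(** Cyclicity of the trace moves the last basis factor next to the Gram matrix, leaving the identity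
    of size [\dim E]. The Gram matrix is invertible because the basis is free. *)
Lemma mxtrace_orthproj E : \tr (orthproj E) = (\dim E)%:R.
Proof.
have unitBB : (basis_mx E)^T *m basis_mx E \in unitmx.
  rewrite -row_free_unit; apply: inj_row_free => x x0.
  apply: trmx_inj; rewrite trmx0.
  have : enorm (basis_mx E *m x^T) ^+ 2 = 0.
    rewrite -tr_mul_enorm trmx_mul trmxK -mulmxA [_^T *m (_ *m _)]mulmxA mulmxA.
    by rewrite x0 mul0mx mxE.
  move=> /enorm2_eq0; rewrite basis_mx_mul => c0.
  apply/matrixP => j k; rewrite (ord1 k) [RHS]mxE.
  have /freeP fE := basis_free (vbasisP E).
  exact: fE (fun j => x^T j 0) c0 j.
by rewrite /orthproj -mulmxA mxtrace_mulC -mulmxA mulVmx// mxtrace1.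
Qed.

Lemma col_mulmx (m n q : nat) (A : 'M[R]_(m, n)) (B : 'M[R]_(n, q)) j :
  col j (A *m B) = A *m col j B.
Proof. by rewrite !colE mulmxA. Qed.

(** Makes the inclusion of a column space in [E] a matrix identity, which can be checked on
    expectations. *)
Lemma orthproj_mul_eq E (A : 'M[R]_p) :
  orthproj E *m A = A <-> (forall j, col j A \in E).
Proof.
split=> [PA j|AE].
  by rewrite -PA col_mulmx; have [] := orthprojP E (col j A).
apply/matrixP => i j; have /matrixP/(_ i 0) := orthproj_id (AE j).
by rewrite -col_mulmx !mxE.
Qed.

Lemma colspace_subP E (A : 'M[R]_p) :
  (colspace A <= E)%VS <-> (forall j, col j A \in E).
Proof.
split=> [/span_subvP sAE j|AE].
  by apply: sAE; apply/mapP; exists j; rewrite ?mem_enum.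
by apply/span_subvP => _ /mapP[j _ ->].
Qed.

(** The witness is the normalized residual of projecting on [F] a vector of [E] outside [F]. *)
Lemma exists_unit_orthogonal E F : (F <= E)%VS -> F != E ->
  exists2 eta, eta \in E & enorm eta = 1 /\ forall u, u \in F -> u^T *m eta = 0.
Proof.
move=> FE FnE.
have [v vE vF] : exists2 v, v \in E & v \notin F.
  have [EF|/subvPn[v vE vF]] := boolP (E <= F)%VS; last by exists v.
  by move: FnE; rewrite eqEsubv FE EF.
have [PvF orth] := orthprojP F v; set x := v - orthproj F *m v in orth.
have x0 : x != 0.
  by apply: contraNneq vF => /eqP; rewrite subr_eq0 => /eqP ->.
have nx0 : enorm x != 0.
  by apply: contraNneq x0 => x0; apply/eqP/enorm2_eq0; rewrite x0 expr0n.
exists ((enorm x)^-1 *: x).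
  by rewrite rpredZ// rpredB// (subvP FE).
split=> [|u uF]; last by rewrite -scalemxAr orth// scaler0.
have : enorm ((enorm x)^-1 *: x) ^+ 2 = 1.
  rewrite -tr_mul_enorm -scalemxAr [_^T]linearZ/= -scalemxAl 2!mxE tr_mul_enorm.
  by field.
move/eqP; rewrite sqrp_eq1 ?sqrtr_ge0// => /eqP//.
Qed.

End orthogonal_projection.

(** * Expectations of random matrices *)

Section matrix_moments.
Set Implicit Arguments.
Unset Strict Implicit.
Context (R : realType) (d : measure_display) (T : measurableType d)
  (P : probability T R).

Lemma measurable_mulmxl (m n : nat) (A : 'M[R]_(m, n)) :
  measurable_fun setT (fun v : 'cV[R]_n => A *m v).
Proof.
apply/measurable_fun_mxP => i j; under eq_fun do rewrite mxE.
by apply: measurable_sum => k; apply: measurable_funM => //; exact: measurable_mx_entry.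
Qed.

Lemma measurable_enorm2 (n : nat) :
  measurable_fun setT (fun v : 'cV[R]_n => enorm v ^+ 2).
Proof.
under eq_fun do rewrite enorm2.
by apply: measurable_sum => k; apply: measurable_funX; exact: measurable_mx_entry.
Qed.

Lemma Rintegral_sum (I : Type) (s : seq I) (f : I -> T -> R) :
  (forall i, integ P (f i)) ->
  \int[P]_w (\sum_(i <- s) f i w) = \sum_(i <- s) \int[P]_w f i w.
Proof.
move=> fi; elim: s => [|i s IHs].
  rewrite big_nil; under eq_Rintegral do rewrite big_nil.
  by rewrite Rintegral_cst// mul0r.
under eq_Rintegral do rewrite big_cons.
by rewrite (RintegralD measurableT (fi i) (integ_sum s fi)) IHs big_cons.
Qed.

Lemma zmean_Rintegral0 (d' : measure_display) (U : measurableType d')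
    (V : T -> U) (f : T -> R) : zmean P V f -> \int[P]_w f w = 0.
Proof. by move=> /zmean_integral0 fE; rewrite /Rintegral fE. Qed.

Lemma mean_mxE (m n : nat) (F : T -> 'M[R]_(m, n)) i j :
  mean_mx P F i j = \int[P]_w F w i j.
Proof. by rewrite mxE unlock. Qed.

Lemma mulmx3E (m n q r : nat) (A : 'M[R]_(m, n)) (F : 'M[R]_(n, q))
    (B : 'M[R]_(q, r)) i j :
  (A *m F *m B) i j = \sum_k \sum_l A i k * B l j * F k l.
Proof.
rewrite mxE exchange_big/=; apply: eq_bigr => l _; rewrite mxE mulr_suml.
by apply: eq_bigr => k _; rewrite mulrAC.
Qed.

Lemma mean_mxM (m n q r : nat) (A : 'M[R]_(m, n)) (F : T -> 'M[R]_(n, q))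
    (B : 'M[R]_(q, r)) :
  (forall i j, integ P (fun w => F w i j)) ->
  (forall i j, integ P (fun w => (A *m F w *m B) i j)) /\
  mean_mx P (fun w => A *m F w *m B) = A *m mean_mx P F *m B.
Proof.
move=> Fi; have ABFi i j k l : integ P (fun w => A i k * B l j * F w k l).
  exact: integZ.
split=> [i j|].
  under eq_fun do rewrite mulmx3E.
  by apply: integ_sum => k; exact: integ_sum.
apply/matrixP => i j; rewrite mean_mxE mulmx3E.
under eq_Rintegral do rewrite mulmx3E.
rewrite Rintegral_sum; last by move=> k; exact: integ_sum.
apply: eq_bigr => k _; rewrite Rintegral_sum//; apply: eq_bigr => l _.
by rewrite (RintegralZl _ measurableT (Fi k l)) mean_mxE.
Qed.

End matrix_moments.

(** * The complementary projection and the centered square *)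

Section orthogonal_complement.
Set Implicit Arguments.
Unset Strict Implicit.
Context (R : realType) (p : nat) (E : {vspace 'cV[R]_p}).
Hypothesis Ep : (\dim E < p)%N.
Implicit Types z : 'cV[R]_p.

Definition coproj : 'M[R]_p := 1%:M - orthproj E.

Lemma trmx_coproj : coproj^T = coproj.
Proof. by rewrite /coproj linearB/= trmx1 trmx_orthproj. Qed.

Lemma coproj_idem : coproj *m coproj = coproj.
Proof.
by rewrite /coproj mulmxBl mul1mx mulmxBr mulmx1 orthproj_idem subrr subr0.
Qed.

Lemma mxtrace_coproj : \tr coproj = (p - \dim E)%:R.
Proof.
by rewrite /coproj linearB/= mxtrace1 mxtrace_orthproj natrB// ltnW.
Qed.

Lemma codim_neq0 : (p - \dim E)%:R != 0 :> R.
Proof. by rewrite pnatr_eq0 -lt0n subn_gt0. Qed.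

Lemma codimV_itv : (0 <= (p - \dim E)%:R^-1 :> R) && ((p - \dim E)%:R^-1 <= 1 :> R).
Proof. by rewrite invr_ge0 ler0n/= invf_le1 ?ler1n ?ltr0n subn_gt0. Qed.

Lemma orthproj_add_coproj z : orthproj E *m z + coproj *m z = z.
Proof. by rewrite -mulmxDl /coproj addrC subrK mul1mx. Qed.

(** Pythagoras, obtained by expanding with symmetric idempotents. *)
Lemma enorm_coproj_le z : enorm (coproj *m z) ^+ 2 <= enorm z ^+ 2.
Proof.
have PP : ((orthproj E *m z)^T *m (orthproj E *m z)) = z^T *m orthproj E *m z.
  rewrite trmx_mul trmx_orthproj mulmxA -[z^T *m _ *m orthproj E]mulmxA.
  by rewrite orthproj_idem.
have QQ : ((coproj *m z)^T *m (coproj *m z)) = z^T *m coproj *m z.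
  by rewrite trmx_mul trmx_coproj mulmxA -[z^T *m _ *m coproj]mulmxA coproj_idem.
have -> : enorm z ^+ 2 = enorm (orthproj E *m z) ^+ 2 + enorm (coproj *m z) ^+ 2.
  have -> : enorm z ^+ 2 = (z^T *m (orthproj E *m z + coproj *m z)) 0 0.
    by rewrite orthproj_add_coproj tr_mul_enorm.
  by rewrite -!tr_mul_enorm PP QQ mulmxDr mxE !mulmxA.
by rewrite lerDr sqr_ge0.
Qed.

Lemma entry_mul_le z i j : `|z i 0 * z j 0| <= enorm z ^+ 2.
Proof.
have := entry_le_enorm z i 0; have := entry_le_enorm z j 0.
rewrite normrM -(real_normK (num_real (z i 0))) -(real_normK (num_real (z j 0))).
move: `|z i 0| `|z j 0| (enorm z ^+ 2) => a b c ? ?.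
have := sqr_ge0 (a - b); nra.
Qed.

(* The psi-matrix of the paper, less [lambda_star], is
   [E[psi(Y) (centered_square Z)]]. *)
Definition centered_square z : 'M[R]_p :=
  z *m z^T - ((p - \dim E)%:R^-1 * enorm (coproj *m z) ^+ 2)%:M.

Lemma centered_squareE z i j : centered_square z i j =
  z i 0 * z j 0 - ((p - \dim E)%:R^-1 * enorm (coproj *m z) ^+ 2) *+ (i == j).
Proof. by rewrite !mxE big_ord1 !mxE. Qed.

Lemma trmx_centered_square z : (centered_square z)^T = centered_square z.
Proof. by rewrite /centered_square linearB/= trmx_mul trmxK tr_scalar_mx. Qed.

(** One squared norm bounds [z *m z^T], the other the scalar part, whose coefficient is at most 1.
    This bound makes products with [psi (Y w)] integrable for [psi] in the weighted space. *)
Lemma centered_square_le z i j :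
  `|centered_square z i j| <= 2 * enorm z ^+ 2.
Proof.
rewrite centered_squareE mulr_natl mulr2n (le_trans (ler_normB _ _))// lerD//.
  exact: entry_mul_le.
have /andP[c0 c1] := codimV_itv.
have c2 : 0 <= (p - \dim E)%:R^-1 * enorm (coproj *m z) ^+ 2.
  by rewrite mulr_ge0// sqr_ge0.
case: (i == j); last by rewrite mulr0n normr0 sqr_ge0.
rewrite mulr1n ger0_norm// (le_trans _ (enorm_coproj_le z))//.
by rewrite ler_piMl// sqr_ge0.
Qed.

Lemma measurable_centered_square i j :
  measurable_fun setT (fun z => centered_square z i j).
Proof.
under eq_fun do rewrite centered_squareE.
apply: measurable_funB.
  by apply: measurable_funM; exact: measurable_mx_entry.
have mQ : measurable_fun setT (fun z => enorm (coproj *m z) ^+ 2).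
  exact: (measurableT_comp (@measurable_enorm2 R p) (measurable_mulmxl coproj)).
case: (i == j) => /=; first exact: measurable_funM.
exact: measurable_cst.
Qed.

(** Splits the first factor [z i 0] along [E] and its complement. At [Z], the first summand is
    handled by the linearity condition, the bracket by the diagonal conditional variance. *)
Lemma centered_square_coproj z i j :
  (centered_square z *m coproj) i j = (coproj *m z) j 0 * (orthproj E *m z) i 0 +
   ((coproj *m z) i 0 * (coproj *m z) j 0 - (p - \dim E)%:R^-1 * coproj i j *
     \sum_k (coproj *m z) k 0 * (coproj *m z) k 0).
Proof.
rewrite /centered_square mulmxBl -mulmxA.
have -> : z^T *m coproj = (coproj *m z)^T by rewrite trmx_mul trmx_coproj.
rewrite mul_scalar_mx [LHS]mxE [X in X + _]mxE big_ord1 [(coproj *m z)^T _ _]mxE.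
rewrite [X in _ + X]mxE [X in _ - X]mxE.
have -> : z i 0 = (orthproj E *m z) i 0 + (coproj *m z) i 0.
  by rewrite -{1}(orthproj_add_coproj z) mxE.
rewrite enorm2.
under eq_bigr do rewrite expr2.
by ring.
Qed.

End orthogonal_complement.

(** * Conditional moments of the standardized vector *)

Section conditional_moments.
Set Implicit Arguments.
Unset Strict Implicit.
Context (R : realType) (d : measure_display) (T : measurableType d)
  (P : probability T R) (p : nat) (Z : T -> 'cV[R]_p) (E : {vspace 'cV[R]_p}).
Hypothesis mZ : measurable_fun setT Z.
Hypothesis Z2 : integ P (fun w => enorm (Z w) ^+ 2).
Hypothesis Ep : (\dim E < p)%N.

Local Notation Pc := (orthproj E).
Local Notation Qc := (coproj E).
Local Notation V := (fun w => orthproj E *m Z w).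

Lemma measurable_mulmx_entry (A : 'M[R]_p) i :
  measurable_fun setT (fun w => (A *m Z w) i 0).
Proof.
have /measurable_fun_mxP mAZ : measurable_fun setT (fun w => A *m Z w).
  exact: (measurableT_comp (measurable_mulmxl A) mZ).
exact: mAZ.
Qed.

Lemma integ_entry i : integ P (fun w => Z w i 0).
Proof.
have /measurable_fun_mxP mZij := mZ.
have one : integ P (cst 1) by exact: finite_measure_integrable_cst.
(* The domination is [a <= 1 + a ^+ 2]. *)
apply: integ_le (integD one Z2) => // w.
have := entry_le_enorm (Z w) i 0; rewrite -(real_normK (num_real (Z w i 0))).
move: `|Z w i 0| (enorm (Z w) ^+ 2) => a b /=.
have := sqr_ge0 (a - 1); nra.
Qed.

Lemma integ_entry_mul i j : integ P (fun w => Z w i 0 * Z w j 0).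
Proof.
have /measurable_fun_mxP mZij := mZ.
apply: integ_le Z2; first exact: measurable_funM.
by move=> w; exact: entry_mul_le.
Qed.

Lemma integ_mulmx_entry_mul (A B : 'M[R]_p) i j :
  integ P (fun w => (A *m Z w) i 0 * (B *m Z w) j 0).
Proof.
have Mi k l : integ P (fun w => (Z w *m (Z w)^T) k l).
  by under eq_fun do rewrite mxE big_ord1 mxE; exact: integ_entry_mul.
have [ABi _] := mean_mxM A B^T Mi.
have := ABi i j; congr (integ _ _); apply/funext => w.
by rewrite -mulmxA -mulmxA -trmx_mul mulmxA mxE big_ord1 [_^T _ _]mxE.
Qed.

Hypothesis linearity : {ae P, forall w, Qc *m cexp_mx P V Z w = 0}.
Hypothesis diag_cvar : exists lambda : {RV P >-> R}, {ae P, forall w,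
  cvar P V Z w = lambda w *: Qc}.

Let mV : measurable_fun setT V.
Proof. exact: (measurableT_comp (measurable_mulmxl Pc) mZ). Qed.

(** Applying [Qc] to [Z - E[Z | V]] keeps a zero conditional mean, and linearity removes [Qc
    E[Z | V]] almost everywhere. *)
Lemma zmean_coproj j : zmean P V (fun w => (Qc *m Z w) j 0).
Proof.
have z : zmean P V (fun w => \sum_k Qc j k *
    (Z w k 0 - cexp P V (fun w' => Z w' k 0) w)).
  by apply: zmean_sum => // k; apply: zmeanZ => //; apply: zmean_cexp => //;
    exact: integ_entry.
apply: (zmean_ae mV _ _ z); first exact: measurable_mulmx_entry.
apply: filterS linearity => w /matrixP/(_ j 0); rewrite [RHS]mxE => QcE.
under eq_bigr do rewrite mulrBr.
rewrite sumrB [RHS]mxE -[RHS]subr0 -[X in _ = _ - X]QcE [X in _ = _ - X]mxE.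
congr (_ - _).
by apply: eq_bigr => k _; rewrite [cexp_mx _ _ _ _ _ _]mxE.
Qed.

(** Linearity kills the component of [E[Z | V]] along [Qc]. The component along [Pc] is [V], since
    [V - Pc E[Z | V]] is a function of [V] with zero conditional mean. This identifies the centering
    inside [cvar]. *)
Lemma cexp_mx_orthproj : {ae P, forall w, cexp_mx P V Z w = V w}.
Proof.
have mr k : measurable_fun setT (regression P V (fun w' => Z w' k 0)).
  by apply: measurable_regression => //; exact: integ_entry.
have PcE : {ae P, forall w i, (Pc *m cexp_mx P V Z w) i 0 = V w i 0}.
  apply: filter_forall => i.
  pose phi (u : 'cV[R]_p) :=
    u i 0 - \sum_k Pc i k * regression P V (fun w' => Z w' k 0) u.
  have mphi : measurable_fun setT phi.
    apply: measurable_funB; first exact: measurable_mx_entry.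
    by apply: measurable_sum => k; apply: measurable_funM => //; exact: mr.
  have z : zmean P V (phi \o V).
    have := @zmean_sum _ _ _ P _ _ V mV _ (index_enum 'I_p)
      (fun k w => Pc i k * (Z w k 0 - cexp P V (fun w' => Z w' k 0) w))
      (fun k => zmeanZ mV _ (zmean_cexp mV (integ_entry k))).
    congr (zmean _ _ _); apply/funext => w; rewrite /phi/= mxE -sumrB.
    by apply: eq_bigr => k _; rewrite mulrBr.
  apply: filterS (zmean_comp_ae0 mV mphi z) => w /eqP; rewrite subr_eq0.
  move=> /eqP ->; rewrite mxE; apply: eq_bigr => k _.
  by rewrite [cexp_mx _ _ _ _ _ _]mxE.
apply: filterS2 linearity PcE => w QE PE.
rewrite -[LHS](orthproj_add_coproj E) QE addr0.
by apply/matrixP => i j; rewrite (ord1 j).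
Qed.

(** Since [E[Z | V] = V], the conditional variance is that of the products of entries of [Qc *m Z],
    so these have conditional mean [lambda * Qc]. The trace of this relation gives [lambda] as the
    conditional mean of the squared norm over [p - \dim E], which eliminates [lambda]. *)
Lemma zmean_coproj_mul i j : zmean P V (fun w =>
  (Qc *m Z w) i 0 * (Qc *m Z w) j 0 - (p - \dim E)%:R^-1 * Qc i j *
    \sum_k (Qc *m Z w) k 0 * (Qc *m Z w) k 0).
Proof.
have [lambda cvarE] := diag_cvar.
have z a b : zmean P V (fun w =>
    (Qc *m Z w) a 0 * (Qc *m Z w) b 0 - lambda w * Qc a b).
  pose f w := ((Z w - cexp_mx P V Z w) *m (Z w - cexp_mx P V Z w)^T) a b.
  have fE : {ae P, forall w, (Qc *m Z w) a 0 * (Qc *m Z w) b 0 = f w}.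
    apply: filterS cexp_mx_orthproj => w cE; rewrite /f cE.
    have -> : Z w - V w = Qc *m Z w by rewrite /coproj mulmxBl mul1mx.
    by rewrite [RHS]mxE big_ord1 [_^T _ _]mxE.
  have mq : measurable_fun setT (fun w => (Qc *m Z w) a 0 * (Qc *m Z w) b 0).
    by apply: measurable_funM; exact: measurable_mulmx_entry.
  have mZc k : measurable_fun setT (fun w => (Z w - cexp_mx P V Z w) k 0).
    have /measurable_fun_mxP mZij := mZ.
    have mc : measurable_fun setT (cexp P V (fun w' => Z w' k 0)).
      exact: (integ_measurable (integ_cexp mV (integ_entry k))).
    have := measurable_funB (mZij k 0) mc.
    by congr (measurable_fun _ _); apply/funext => w; rewrite !mxE.
  have mf : measurable_fun setT f.
    have := measurable_funM (mZc a) (mZc b).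
    congr (measurable_fun _ _); apply/funext => w.
    by rewrite /f mxE big_ord1 [_^T _ _]mxE.
  have fi : integ P f by exact: integ_ae mf (integ_mulmx_entry_mul _ _ a b) fE.
  apply: (zmean_ae mV _ _ (zmean_cexp mV fi)).
    by apply: measurable_funB => //; exact: measurable_funM.
  apply: filterS2 cvarE fE => w /matrixP/(_ a b); rewrite mxE => cE ->.
  by rewrite [in RHS]mxE in cE; rewrite -cE.
(* The terms in [lambda] cancel because the trace of [Qc] is [p - \dim E]. *)
have := zmeanB mV (z i j) (zmeanZ mV ((p - \dim E)%:R^-1 * Qc i j)
   (@zmean_sum _ _ _ P _ _ V mV _ (index_enum 'I_p) _ (fun k => z k k))).
congr (zmean _ _ _); apply/funext => w.
have lE : \sum_k lambda w * Qc k k = lambda w * (p - \dim E)%:R.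
  by rewrite -mulr_sumr -(mxtrace_coproj Ep).
rewrite sumrB lE; have := codim_neq0 Ep.
move: (\sum_k _) ((p - \dim E)%:R : R) => s n n0.
by field.
Qed.

Lemma zmean_centered_square i j :
  zmean P V (fun w => (centered_square E (Z w) *m Qc) i j).
Proof.
(* The factor [(Pc *m Z w) i 0] is a coordinate of [V] and can be pulled out. *)
have z1 : zmean P V (fun w => (Qc *m Z w) j 0 * (Pc *m Z w) i 0).
  apply: (@zmean_mul _ _ _ P _ _ V mV _ (fun u : 'cV[R]_p => u i 0)).
  - exact: zmean_coproj.
  - exact: measurable_mx_entry.
  - exact: integ_mulmx_entry_mul.
have := zmeanD mV z1 (zmean_coproj_mul i j).
by congr (zmean _ _ _); apply/funext => w; rewrite centered_square_coproj.
Qed.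

End conditional_moments.

(** * The psi-spaces *)

Section psi_spaces.
Set Implicit Arguments.
Unset Strict Implicit.
Context (R : realType) (d : measure_display) (T : measurableType d)
  (P : probability T R) (p : nat) (Y : {RV P >-> R}) (Z : T -> 'cV[R]_p)
  (E : {vspace 'cV[R]_p}).
Hypothesis mZ : measurable_fun setT Z.
Hypothesis Z2 : integ P (fun w => enorm (Z w) ^+ 2).
Hypothesis Ep : (\dim E < p)%N.
Implicit Types psi u : R -> R.

Local Notation L1Z := (in_L1 (regression P Y (fun w => enorm (Z w) ^+ 2))
  (distribution P Y)).

Let mY : measurable_fun setT Y. Proof. by []. Qed.

Let mZ2 : measurable_fun setT (fun w => enorm (Z w) ^+ 2).
Proof. exact: integ_measurable Z2. Qed.

Let L1_seminormE u : measurable_fun setT u ->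
  L1_seminorm (regression P Y (fun w => enorm (Z w) ^+ 2)) (distribution P Y) u =
  (\int[P]_w (enorm (Z w) ^+ 2 * `|u (Y w)|)%:E)%E.
Proof. by move=> mu; apply: L1_seminorm_regression => // w; exact: sqr_ge0. Qed.

Lemma in_L1_integ psi : L1Z psi ->
  integ P (fun w => enorm (Z w) ^+ 2 * `|psi (Y w)|).
Proof.
move=> [mpsi]; rewrite L1_seminormE// => fin.
have mpY : measurable_fun setT (psi \o Y) by exact: measurableT_comp.
apply/integrableP; split.
  by apply/measurable_EFinP; apply: measurable_funM => //; exact: measurableT_comp.
apply: le_lt_trans fin; apply: ge0_le_integral => //.
- apply/measurable_EFinP; apply: measurableT_comp => //; apply: measurable_funM => //.
  exact: measurableT_comp.
- by apply/measurable_EFinP; apply: measurable_funM => //; exact: measurableT_comp.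
- by move=> w _; rewrite /= ger0_norm// mulr_ge0// sqr_ge0.
Qed.

Lemma indic_in_L1 (A : set R) : measurable A -> L1Z \1_A.
Proof.
move=> mA; have m1 : measurable_fun setT (\1_A : R -> R) by exact: measurable_indic.
split=> //; rewrite L1_seminormE//.
have m1Y : measurable_fun setT ((\1_A : R -> R) \o Y) by exact: measurableT_comp.
have i1 : integ P (fun w => enorm (Z w) ^+ 2 * `|\1_A (Y w)|).
  apply: integ_le Z2.
    by apply: measurable_funM => //; exact: measurableT_comp.
  move=> w; rewrite normrM normr_id ger0_norm ?sqr_ge0// ler_piMr ?sqr_ge0//.
  by rewrite ger0_norm// indicE lern1 leq_b1.
exact: integrable_lty i1.
Qed.

Lemma integ_L1_mul psi (g : T -> R) (C : R) : measurable_fun setT g ->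
  (forall w, `|g w| <= C * enorm (Z w) ^+ 2) -> L1Z psi ->
  integ P (fun w => g w * psi (Y w)).
Proof.
move=> mg gC psiL1; apply: integ_le (integZ C (in_L1_integ psiL1)).
  by apply: measurable_funM => //; apply: measurableT_comp => //; case: psiL1.
by move=> w; rewrite normrM mulrA ler_wpM2r.
Qed.

Lemma measurable_cs_entry i j :
  measurable_fun setT (fun w => centered_square E (Z w) i j).
Proof. exact: (measurableT_comp (@measurable_centered_square _ _ E i j) mZ). Qed.

Section one_psi.
Variable psi : R -> R.
Hypothesis psiL1 : L1Z psi.

Definition psi_centered w := psi (Y w) *: centered_square E (Z w).

Lemma integ_psi_centered i j : integ P (fun w => psi_centered w i j).
Proof.
have := integ_L1_mul (measurable_cs_entry i j)
  (fun w => centered_square_le Ep (Z w) i j) psiL1.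
by congr (integ _ _); apply/funext => w; rewrite /psi_centered [RHS]mxE mulrC.
Qed.

Lemma mean_psi_centered :
  psi_matrix P Y Z psi - (lambda_star P Y Z E psi)%:M = mean_mx P psi_centered.
Proof.
have /measurable_fun_mxP mZij := mZ.
have i1 i j : integ P (fun w => Z w i 0 * Z w j 0 * psi (Y w)).
  apply: (@integ_L1_mul _ _ 1) => //; first exact: measurable_funM.
  by move=> w; rewrite mul1r; exact: entry_mul_le.
have i2 : integ P (fun w => enorm (coproj E *m Z w) ^+ 2 * psi (Y w)).
  apply: (@integ_L1_mul _ _ 1) => //.
    apply: (measurableT_comp (@measurable_enorm2 R p)).
    exact: (measurableT_comp (measurable_mulmxl (coproj E)) mZ).
  by move=> w; rewrite mul1r ger0_norm ?sqr_ge0//; exact: enorm_coproj_le.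
apply/matrixP => i j; rewrite mean_mxE [LHS]mxE [X in X + _]mean_mxE.
rewrite [X in _ + X]mxE [X in _ - X]mxE.
have -> : lambda_star P Y Z E psi = (p - \dim E)%:R^-1 *
    \int[P]_w (enorm (coproj E *m Z w) ^+ 2 * psi (Y w)).
  by rewrite /lambda_star unlock.
(* The diagonal condition becomes a factor 0 or 1, so that it can enter the integral and both sides
   become one integral. *)
rewrite -(RintegralZl _ measurableT i2) -[_ *+ (i == j)]mulr_natr.
rewrite -(RintegralZr _ measurableT (integZ _ i2)).
have i3 := integZ (i == j)%:R (integZ (p - \dim E)%:R^-1 i2).
under [X in _ - X]eq_Rintegral do rewrite mulrC.
have -> : \int[P]_w (psi (Y w) *: (Z w *m (Z w)^T)) i j =
    \int[P]_w (Z w i 0 * Z w j 0 * psi (Y w)).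
  by apply: eq_Rintegral => w _; rewrite [LHS]mxE [X in _ * X]mxE big_ord1 mxE mulrC.
rewrite -(RintegralB measurableT (i1 i j) i3).
apply: eq_Rintegral => w _.
rewrite /psi_centered [RHS]mxE centered_squareE -[_ *+ (i == j)]mulr_natr.
by ring.
Qed.

Hypothesis zG : forall i j,
  zmean P Y (fun w => (centered_square E (Z w) *m coproj E) i j).

Lemma trmx_mean_psi_centered :
  (mean_mx P psi_centered)^T = mean_mx P psi_centered.
Proof.
apply/matrixP => i j; rewrite mxE !mean_mxE; apply: eq_Rintegral => w _.
rewrite /psi_centered [LHS]mxE [RHS]mxE.
by rewrite -[in RHS]trmx_centered_square [X in _ = _ * X]mxE.
Qed.

(** Testing [zG] against [psi (Y w)] gives [N *m coproj E = 0]. As [N] is symmetric,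
    [coproj E *m N = 0] as well, so projecting on [E] fixes every column of [N]. *)
Lemma psi_space_sub : (psi_space P Y Z E psi <= E)%VS.
Proof.
rewrite /psi_space mean_psi_centered.
apply/colspace_subP/orthproj_mul_eq; set N := mean_mx _ _.
have NQ : N *m coproj E = 0.
  have [GQi GQ] := mean_mxM 1%:M (coproj E) integ_psi_centered.
  rewrite mul1mx in GQ; rewrite -GQ; apply/matrixP => i j; rewrite mean_mxE [RHS]mxE.
  have FE w : (1%:M *m psi_centered w *m coproj E) i j =
      (centered_square E (Z w) *m coproj E) i j * psi (Y w).
    by rewrite mul1mx /psi_centered -scalemxAl mxE mulrC.
  have Fi : integ P (fun w =>
      (centered_square E (Z w) *m coproj E) i j * psi (Y w)).
    by have := GQi i j; congr (integ _ _); apply/funext => w; rewrite FE.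
  under eq_Rintegral do rewrite FE.
  have [mpsi _] := psiL1.
  exact: (zmean_Rintegral0 (zmean_mul mY (zG i j) mpsi Fi)).
have QN : coproj E *m N = 0.
  apply: trmx_inj; rewrite trmx_mul trmx_coproj trmx0.
  by rewrite /N trmx_mean_psi_centered.
by move/eqP: QN; rewrite /coproj mulmxBl mul1mx subr_eq0 => /eqP.
Qed.

End one_psi.

(** The bound on [g] makes the functional sending [u] to [E[g u(Y)]] continuous for the weighted
    seminorm. It vanishes on [Psi], hence on the span, hence by density on indicators of Borel
    sets. *)
Lemma total_zmean (g : T -> R) (C : R) (Psi : set (R -> R)) :
  measurable_fun setT g -> (forall w, `|g w| <= C * enorm (Z w) ^+ 2) ->
  total_in_L1 (regression P Y (fun w => enorm (Z w) ^+ 2)) (distribution P Y) Psi ->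
  (forall psi, Psi psi -> \int[P]_w (g w * psi (Y w)) = 0) ->
  zmean P Y g.
Proof.
move=> mg gC [PsiL1 dense] gPsi.
have gi : integ P g by exact: (integ_le mg gC (integZ C Z2)).
split=> // A mA.
have m1 : measurable_fun setT (\1_A : R -> R) by exact: measurable_indic.
have A1 := indic_in_L1 mA.
have g1i := integ_L1_mul mg gC A1.
rewrite integral_preimage.
rewrite -[LHS]fineK; last exact: (integrable_fin_num measurableT g1i).
congr EFin; apply/eqP; rewrite -normr_le0; apply/ler_addgt0Pr => e e0.
rewrite add0r.
(* [C] may be zero or negative; [C1] is a positive upper bound of it, so approximation within
   [e / C1] makes sense and leaves an error of at most [e]. *)
pose C1 := `|C| + 1.
have C10 : 0 < C1 by rewrite ltr_wpDl.
have [v [n [c [h [Psih vE]]]] veps] := dense _ A1 (e / C1) (divr_gt0 e0 C10).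
have hi i : integ P (fun w => g w * h i (Y w)).
  exact: (integ_L1_mul mg gC (PsiL1 _ (Psih i))).
have vsum w : g w * v (Y w) = \sum_i c i * (g w * h i (Y w)).
  by rewrite vE mulr_sumr; apply: eq_bigr => i _; rewrite mulrCA.
have vi : integ P (fun w => g w * v (Y w)).
  by under eq_fun do rewrite vsum; apply: integ_sum => i; exact: integZ.
have v0 : \int[P]_w (g w * v (Y w)) = 0.
  under eq_Rintegral do rewrite vsum.
  rewrite Rintegral_sum => [|i]; last exact: integZ.
  rewrite big1// => i _; rewrite (RintegralZl _ measurableT (hi i)).
  by rewrite gPsi ?mulr0.
have mv : measurable_fun setT v.
  rewrite vE; apply: measurable_sum => i; apply: measurable_funM => //.
  by have [] := PsiL1 _ (Psih i).
have muv : measurable_fun setT (\1_A \- v) by exact: measurable_funB.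
have uvL1 : L1Z (\1_A \- v).
  by split=> //; apply: lt_trans veps _; rewrite ltry.
have uvi := in_L1_integ uvL1.
have guvi := integ_L1_mul mg gC uvL1.
have -> : fine (\int[P]_w (g w * \1_A (Y w))%:E)%E =
    \int[P]_w (g w * (\1_A \- v) (Y w)).
  rewrite -[LHS]subr0 -[X in _ - X]v0 -(RintegralB measurableT g1i vi).
  by apply: eq_Rintegral => w _; rewrite /= mulrBr.
apply: (le_trans (le_normr_Rintegral measurableT guvi)).
apply: (@le_trans _ _ (C1 *
    \int[P]_w (enorm (Z w) ^+ 2 * `|(\1_A \- v) (Y w)|))).
  rewrite -(RintegralZl _ measurableT uvi).
  apply: le_Rintegral (integ_abs guvi) (integZ C1 uvi) _ => // w _.
  rewrite normrM mulrA ler_wpM2r// (le_trans (gC w))//.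
  by rewrite ler_wpM2r ?sqr_ge0// (le_trans (ler_norm C))// lerDl.
rewrite -ler_pdivlMl// mulrC -lee_fin.
rewrite /Rintegral fineK; last exact: (integrable_fin_num measurableT uvi).
by rewrite -L1_seminormE// ltW.
Qed.

End psi_spaces.

(** * A finite subfamily whose psi-spaces span the central subspace *)

Theorem corollary4p4 (R : realType) (d : measure_display)
  (T : measurableType d) (P : probability T R) (p : nat)
  (Y : {RV P >-> R}) (X : {RV P >-> 'cV[R]_p})
  (* X has an invertible covariance matrix Sigma, and S = Sigma^(-1/2) *)
  (X_L2 : forall i, (fun w => X w i 0) \in Lfun P 2%:E)
  (Sigma_unit : covariance_mx P X \in unitmx)
  (S : 'M[R]_p) (S_invsqrt : is_invsqrt (covariance_mx P X) S)
  (* X has a density whose support has a negligible boundary *)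
  (X_density : has_density (distribution P X))
  (X_support :
     lebesgue_cV R p (boundary (law_support (distribution P X))) = 0%E)
  (Z : T -> 'cV[R]_p) (Z_def : Z = standardize P X S)
  (Z_L2 : ('E_P[fun w => (enorm (Z w) ^+ 2)%R] < +oo)%E)
  (Ec : {vspace 'cV[R]_p}) (Ec_central : is_central_subspace P Y Z Ec)
  (Ec_lt_p : (\dim Ec < p)%N)
  (Pc Qc : 'M[R]_p) (Pc_def : Pc = orthproj Ec) (Qc_def : Qc = 1%:M - Pc)
  (linearity : {ae P, forall w,
     Qc *m cexp_mx P (fun w' => Pc *m Z w') Z w = 0})
  (diag_cvar : exists lambda : {RV P >-> R}, {ae P, forall w,
     cvar P (fun w' => Pc *m Z w') Z w = lambda w *: Qc})
  (coverage : forall eta : 'cV[R]_p, eta \in Ec -> enorm eta = 1 ->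
     (P [set w | (cexp P Y (fun w' => (eta^T *m Z w') 0 0 ^+ 2) w =
                  cexp P Y (fun w' => enorm (Qc *m Z w') ^+ 2 /
                                      (p - \dim Ec)%:R) w)%R] < 1)%E)
  (Psi : set (R -> R)) (Psi_countable : countable Psi)
  (Psi_total : total_in_L1 (regression P Y (fun w => enorm (Z w) ^+ 2))
                           (distribution P Y) Psi) :
  exists PsiH : set (R -> R),
    [/\ finite_set PsiH, PsiH `<=` Psi &
        (\big[addv/0%VS]_(psi \in PsiH) psi_space P Y Z Ec psi)%VS = Ec].
Proof.
have mZ : measurable_fun setT Z.
  have mX : measurable_fun setT X by [].
  rewrite Z_def; apply: (measurableT_comp (measurable_mulmxl S)).
  apply/measurable_fun_mxP => i j; under eq_fun do rewrite mxE.
  by apply: measurable_funD => //; move: i j; exact/measurable_fun_mxP.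
have Z2 : integ P (fun w => enorm (Z w) ^+ 2).
  apply/integrableP; split.
    by apply/measurable_EFinP; exact: (measurableT_comp (@measurable_enorm2 R p)).
  move: Z_L2; rewrite unlock; under eq_integral do
    rewrite -(ger0_norm (sqr_ge0 (enorm (Z _)))) -abse_EFin.
  by [].
have QE : Qc = coproj Ec by rewrite Qc_def Pc_def.
rewrite {}QE {}Pc_def in linearity diag_cvar coverage *.
have mY : measurable_fun setT Y by [].
have [indep _ _] := Ec_central.
have mcs i j : measurable_fun setT
    (fun z : 'cV[R]_p => (centered_square Ec z *m coproj Ec) i j).
  under eq_fun do rewrite mxE.
  apply: measurable_sum => k; apply: measurable_funM => //.
  exact: measurable_centered_square.
(* The zero mean given the projection of [Z] passes to [Y] because [Ec] is itself a dimension
   reduction subspace. *)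
have zG i j : zmean P Y (fun w => (centered_square Ec (Z w) *m coproj Ec) i j).
  apply: (zmean_cond_indep mY mZ (measurable_mulmxl (orthproj Ec)) (mcs i j) indep).
  exact: zmean_centered_square.
have [PsiL1 _] := Psi_total.
have [D [fD DPsi supD]] := finite_fsumv_sup (psi_space P Y Z Ec) Psi.
exists D; split => //; set F := (\big[_/_]_(_ \in _) _).
have FE : (F <= Ec)%VS.
  apply: (fsumv_supP _ fD).2 => psi /DPsi/PsiL1 psiL1.
  exact: psi_space_sub psiL1 zG.
apply/eqP/negP => /negP FnE.
have [eta etaE [eta1 orth]] := exists_unit_orthogonal FE FnE.
pose g w := (eta^T *m centered_square Ec (Z w) *m eta) 0 0.
(* The unit norm of [eta] turns the scalar part into exactly the right-hand quantity of the coverage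
   condition. *)
have gE w : g w = (eta^T *m Z w) 0 0 ^+ 2 -
    enorm (coproj Ec *m Z w) ^+ 2 / (p - \dim Ec)%:R.
  rewrite /g /centered_square mulmxBr mulmxBl mul_mx_scalar -scalemxAl.
  rewrite [LHS]mxE [X in _ + X]mxE [X in _ - X]mxE tr_mul_enorm eta1 expr1n mulr1.
  rewrite [in RHS]mulrC; congr (_ - _).
  rewrite mulmxA -mulmxA [LHS]mxE big_ord1 expr2; congr (_ * _).
  by rewrite -[in RHS](trmxK (Z w)) -trmx_mul [RHS]mxE.
pose C := \sum_k \sum_l `|eta^T 0 k * eta l 0| * 2.
have gC w : `|g w| <= C * enorm (Z w) ^+ 2.
  rewrite /g mulmx3E mulr_suml (le_trans (ler_norm_sum _ _ _))//.
  apply: ler_sum => k _; rewrite mulr_suml (le_trans (ler_norm_sum _ _ _))//.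
  apply: ler_sum => l _; rewrite normrM -mulrA ler_wpM2l//.
  exact: centered_square_le.
have mg : measurable_fun setT g.
  rewrite /g; under eq_fun do rewrite mulmx3E.
  apply: measurable_sum => k; apply: measurable_sum => l.
  apply: measurable_funM => //; exact: measurable_cs_entry.
have gPsi psi : Psi psi -> \int[P]_w (g w * psi (Y w)) = 0.
  move=> Psipsi; have psiL1 := PsiL1 _ Psipsi.
  have [_ GE] := mean_mxM eta^T eta (integ_psi_centered mZ Z2 Ec_lt_p psiL1).
  (* By symmetry the rows of this matrix are its columns, which lie in [F] and are orthogonal to
     [eta]. *)
  have Neta : mean_mx P (psi_centered Y Z Ec psi) *m eta = 0.
    rewrite -trmx_mean_psi_centered; apply/matrixP => j i; rewrite [RHS]mxE.
    have : col j (mean_mx P (psi_centered Y Z Ec psi)) \in F.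
      rewrite -mean_psi_centered//.
      by apply: (colspace_subP _ _).1; exact: supD.
    move=> /orth/matrixP/(_ 0 i); rewrite [RHS]mxE => <-.
    by rewrite !mxE; apply: eq_bigr => k _; rewrite !mxE.
  move: GE; rewrite -mulmxA Neta mulmx0 => /matrixP/(_ 0 0).
  rewrite mean_mxE [RHS]mxE => <-; apply: eq_Rintegral => w _.
  by rewrite /psi_centered -scalemxAr -scalemxAl mxE mulrC.
have gz := total_zmean Z2 mg gC Psi_total gPsi.
pose f1 w := (eta^T *m Z w) 0 0 ^+ 2.
pose f2 w := enorm (coproj Ec *m Z w) ^+ 2 / (p - \dim Ec)%:R.
have f2i : integ P f2.
  have Qi : integ P (fun w => enorm (coproj Ec *m Z w) ^+ 2).
    apply: integ_le Z2 => [|w].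
      apply: (measurableT_comp (@measurable_enorm2 R p)).
      exact: (measurableT_comp (measurable_mulmxl (coproj Ec)) mZ).
    by rewrite ger0_norm ?sqr_ge0//; exact: enorm_coproj_le.
  have := integZ (p - \dim Ec)%:R^-1 Qi.
  by congr (integ _ _); apply/funext => w; rewrite /f2 mulrC.
(* [f1] is [g + f2], both integrable. *)
have f1i : integ P f1.
  have := integD gz.1 f2i.
  by congr (integ _ _); apply/funext => w; rewrite gE subrK.
(* The difference of regressions is [g + (f2 - E[f2 | Y]) - (f1 - E[f1 | Y])]. Being a function of
   [Y] with zero mean given [Y], it vanishes almost everywhere. *)
have z12 : zmean P Y ((fun y => regression P Y f1 y - regression P Y f2 y) \o Y).
  have := zmeanB mY (zmeanD mY gz (zmean_cexp mY f2i)) (zmean_cexp mY f1i).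
  by congr (zmean _ _ _); apply/funext => w; rewrite gE /cexp/= /f1 /f2; ring.
have m12 : measurable_fun setT (fun y => regression P Y f1 y - regression P Y f2 y).
  by apply: measurable_funB; exact: measurable_regression.
have := coverage eta etaE eta1; apply/negP; rewrite -leNgt -/f1 -/f2.
set A := [set w | _].
have mA : measurable A.
  have -> : A = Y @^-1` ((fun y => regression P Y f1 y - regression P Y f2 y)
      @^-1` [set 0]).
    apply/seteqP; split=> w; rewrite /A/= /cexp/=; first by move=> ->; rewrite subrr.
    by move=> /eqP; rewrite subr_eq0 => /eqP.
  rewrite -[X in measurable X]setTI; apply: mY => //.
  by rewrite -[X in measurable X]setTI; exact: m12.
have [N [mN PN sN]] := zmean_comp_ae0 mY m12 z12.
(* The coverage event thus has probability 1, which contradicts the strict inequality. *)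
have PA0 : P (~` A) = 0%E.
  apply/eqP; rewrite eq_le measure_ge0 andbT -PN.
  apply: (@le_measure _ _ _ P); rewrite ?inE//; first exact: measurableC.
  by apply: subset_trans sN => w nA /= /eqP; rewrite subr_eq0 => /eqP.
by rewrite -[A]setCK probability_setC ?PA0 ?sube0//; exact: measurableC.
Qed.
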